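(* Let $d\ge 1$, $k\in\{0,1,\ldots,d\}$, and consider a great hypersphere tessellation of $\mathbb{S}^d$ with non-degenerate directional distribution $\kappa$ and intensity $n\ge d-k$. Let $h:\mathbb{K}_s(d)\to\mathbb{R}$ be a non-negative measurable function. Then $$\mathbf{E}\,h(Z_{n,d}^{(k)})=\int_{\mathbb{G}_s(d,k)}\mathbf{E}\,h(Z_{n-d+k,S})\,\kappa_k(\mathrm{d}S),$$ where $Z_{n-d+k,S}$ is the typical cell of the sectional tessellation $T_{n-d+k,S}=T_{n-d+k,d}\cap S$.
   Context: $\mathbb{S}^d$ is the unit sphere of $\mathbb{R}^{d+1}$. For $k\in\{0,\ldots,d\}$, $\mathbb{G}_s(d,k)$ is the set of $k$-dimensional great subspheres of $\mathbb{S}^d$ (intersections of $\mathbb{S}^d$ with $(k+1)$-dimensional linear subspaces); elements of $\mathbb{G}_s(d,d-1)$ are great hyperspheres. $\mathbb{K}_s(d)$ is the set of all $C\cap\mathbb{S}^d$ with $C\subset\mathbb{R}^{d+1}$ a closed convex cone different from $\{0\}$, with the Borel $\sigma$-field of the spherical Hausdorff distance. A spherical polytope is $P=C\cap\mathbb{S}^d$ with $C\ne\{0\}$ a polyhedral cone; its $\ell$-dimensional faces are the intersections of $\mathbb{S}^d$ with the $(\ell+1)$-dimensional faces of $C$; $\mathcal{F}_\ell(P)$ is the set of these. Tessellation: let $\kappa^\circ$ be an even Borel probability measure on $\mathbb{S}^d$ with $\kappa^\circ(S)=0$ for every $S\in\mathbb{G}_s(d,d-1)$, and let $\kappa$ be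 its image under $u\mapsto u^\perp\cap\mathbb{S}^d$; such a $\kappa$ is what is meant here by a non-degenerate directional distribution. For $n\ge1$ let $S_1,\ldots,S_n$ be independent random great hyperspheres with distribution $\kappa$. The great hypersphere tessellation $T_{n,d}=T_d(S_1,\ldots,S_n)$ of intensity $n$ and directional distribution $\kappa$ is the random finite collection of spherical polytopes (cells) that are the closures of the connected components of $\mathbb{S}^d\setminus(S_1\cup\cdots\cup S_n)$; $T_{0,d}=\{\mathbb{S}^d\}$. Put $\mathcal{F}_k(T_{n,d})=\bigcup_{P\in T_{n,d}}\mathcal{F}_k(P)$. Typical spherical $k$-face: given $T_{n,d}$, $Z_{n,d}^{(k)}$ is chosen uniformly at random from the almost surely finite set $\mathcal{F}_k(T_{n,d})$. For fixed $S\in\mathbb{G}_s(d,k)$ and $m\ge0$, $T_{m,S}=T_{m,d}\cap S$ is the collection of cells $P\cap S$, $P\in T_{m,d}$ with interior meeting $S$ (where $T_{m,d}$ has directional distribution $\kappa$); its typical cell $Z_{m,S}$ is chosen uniformly at random among its cells. For $k\le d-1$, $\kappa_k$ is the distribution of $S_1\cap\cdots\cap S_{d-k}$ where $S_1,\ldots,S_{d-k}$ are independent with distribution $\kappa$ (a probability measure on $\mathbb{G}_s(d,k)$); $\kappa_d$ is the unit point mass at $\mathbb{S}^d$. *)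

(* Defs.v *)
From HB Require Import structures.
From mathcomp Require Import all_boot all_order all_algebra finmap.
From mathcomp Require Import all_classical all_reals all_analysis.

Set Implicit Arguments.
Unset Strict Implicit.
Unset Printing Implicit Defensive.

Import Order.TTheory GRing.Theory Num.Theory.
Import numFieldNormedType.Exports.

Local Open Scope classical_set_scope.
Local Open Scope ring_scope.

(** Subsets of the unit sphere S^d of R^(d+1) are represented as sets of row
    vectors of length d+1. The library norm on row vectors is the sup norm, so
    the Euclidean structure is spelled out through [dot]; the topologies
    agree. *)

Section Sphere.
Context {R : realType} {d : nat}.
Local Notation E := 'rV[R]_d.+1.
Implicit Types (x y a : E) (K L C F G P : set E).

Definition dot x y : R := \sum_(i < d.+1) x ord0 i * y ord0 i.

Definition sphere : set E := [set x | dot x x = 1].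

Lemma sphere_nonempty : sphere (delta_mx 0 0).
Proof.
rewrite /sphere /dot /= (bigD1 ord0)//= big1 ?mxE ?eqxx ?mulr1 ?addr0//.
by move=> i i0; rewrite !mxE (negbTE i0) mulr0.
Qed.

Definition great_subsphere (k : nat) L : Prop :=
  exists2 V : {vspace E}, \dim V = k.+1 & L = [set x | x \in V] `&` sphere.

Definition polar_hypersphere x : set E := [set y | dot x y = 0] `&` sphere.

Definition convex_cone C : Prop :=
  [/\ C 0, convex_set C & forall (t : R) x, 0 <= t -> C x -> C (t *: x)].

Definition polyhedral_cone C : Prop :=
  exists m (a : 'I_m -> E), C = [set x | forall i, dot (a i) x <= 0].

(* [a = 0] is allowed and gives [C] itself; a supporting hyperplane of a cone
   passes through the origin. *)
Definition cone_face C F : Prop :=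
  exists2 a, (forall x, C x -> dot a x <= 0) &
             F = C `&` [set x | dot a x = 0].

(* [m] is the dimension of the linear hull of [G]. *)
Definition lin_dim (m : nat) G : Prop :=
  exists V : {vspace E}, [/\ \dim V = m, G `<=` [set x | x \in V] &
    forall W : {vspace E}, G `<=` [set x | x \in W] -> (V <= W)%VS].

Definition polytope_faces (l : nat) P : set (set E) :=
  [set F | exists C G, [/\ polyhedral_cone C, C <> [set 0], P = C `&` sphere,
     cone_face C G /\ lin_dim l.+1 G & F = G `&` sphere]].

Definition geodist x y : R := acos (dot x y).

Definition geodist_set x L : R := inf [set geodist x y | y in L].

Definition hausdorff_dist K L : R :=
  Num.max (sup [set geodist_set x L | x in K])
          (sup [set geodist_set y K | y in L]).

Definition tessellation (n : nat) (S : 'I_n -> set E) : set (set E) :=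
  if n is 0%N then [set sphere]
  else let U := sphere `\` \bigcup_i S i in
       [set closure (connected_component U x) | x in U].

Definition tess_faces (k : nat) (T : set (set E)) : set (set E) :=
  \bigcup_(P in T) polytope_faces k P.

Definition sphere_interior P : set E :=
  [set x | P x /\ \forall y \near x, sphere y -> P y].

Definition section_tess (T : set (set E)) L : set (set E) :=
  [set P `&` L | P in [set P | T P /\ sphere_interior P `&` L !=set0]].

End Sphere.

Arguments sphere R d : clear implicits.

Definition sphere_point (R : realType) (d : nat) : Type :=
  set_type (sphere R d).

HB.instance Definition _ (R : realType) (d : nat) :=
  Topological.copy (sphere_point R d) (set_type (sphere R d)).
HB.instance Definition _ (R : realType) (d : nat) :=
  isPointed.Build (sphere_point R d)
    (exist _ (delta_mx 0 0) (mem_set (sphere_nonempty (R := R) (d := d)))).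
HB.instance Definition _ (R : realType) (d : nat) :=
  Measurable.copy (sphere_point R d)
    (g_sigma_algebraType (@open (sphere_point R d))).

Definition sphere_val (R : realType) (d : nat) (u : sphere_point R d) :
  'rV[R]_d.+1 := set_val u.

Definition spherically_convex (R : realType) (d : nat) :
    set (set 'rV[R]_d.+1) :=
  [set K | exists C, [/\ convex_cone C, closed C, C <> [set 0] &
                         K = C `&` sphere R d]].

Record sconvex (R : realType) (d : nat) := SConvex {
  sconvex_set :> set 'rV[R]_d.+1 ;
  sconvexP : spherically_convex sconvex_set }.

Lemma sphere_spherically_convex (R : realType) (d : nat) :
  spherically_convex (sphere R d).
Proof.
exists setT; split.
- by split.
- exact: closedT.
- move=> /seteqP[/(_ (delta_mx 0 0) I)/= /matrixP /(_ 0 0) + _].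
  by rewrite !mxE eqxx => /eqP; rewrite oner_eq0.
- by rewrite setTI.
Qed.

Definition hausdorff_open (R : realType) (d : nat) : set (set (sconvex R d)) :=
  [set U | forall K : sconvex R d, U K -> exists2 e : R, 0 < e &
     forall L : sconvex R d, hausdorff_dist K L < e -> U L].

HB.instance Definition _ (R : realType) (d : nat) :=
  gen_eqMixin (sconvex R d).
HB.instance Definition _ (R : realType) (d : nat) :=
  gen_choiceMixin (sconvex R d).
HB.instance Definition _ (R : realType) (d : nat) :=
  isPointed.Build (sconvex R d) (SConvex (@sphere_spherically_convex R d)).
HB.instance Definition _ (R : realType) (d : nat) :=
  Measurable.copy (sconvex R d) (g_sigma_algebraType (@hausdorff_open R d)).

(* G_s(d,k), with the trace of the Borel sigma-field of K_s(d). *)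
Definition great_subspheres (R : realType) (d k : nat) : set (sconvex R d) :=
  [set L | great_subsphere k L].

Definition nondegenerate_directional (R : realType) (d : nat)
    (kappa : probability (sconvex R d) R) : Prop :=
  exists kappa0 : probability (sphere_point R d) R,
    [/\ (forall A : set (sphere_point R d), measurable A ->
           kappa0 [set u | exists2 v, A v & sphere_val v = - sphere_val u]
           = kappa0 A),
        (forall L : set 'rV[R]_d.+1, great_subsphere d.-1 L ->
           kappa0 [set u | L (sphere_val u)] = 0%E) &
        (forall A, measurable A -> kappa A =
           kappa0 [set u | exists2 K : sconvex R d,
                     A K & polar_hypersphere (sphere_val u) = K])].

Section RandomTessellation.
Context {R : realType} {d : nat}.
Context {dO : measure_display} {Omega : measurableType dO}.
Context {P : probability Omega R}.
Local Notation E := 'rV[R]_d.+1.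

Definition mutually_independent (n : nat)
    (X : 'I_n -> {RV P >-> sconvex R d}) : Prop :=
  forall (J : {set 'I_n}) (A : 'I_n -> set (sconvex R d)),
    (forall i, measurable (A i)) ->
    P (\bigcap_(i in [set` J]) (X i @^-1` A i)) =
    (\prod_(i in J) P (X i @^-1` A i))%E.

Definition iid_hyperspheres (kappa : probability (sconvex R d) R) (n : nat)
    (S : 'I_n -> {RV P >-> sconvex R d}) : Prop :=
  [/\ forall i w, great_subspheres d.-1 (S i w),
      forall i A, measurable A -> distribution P (S i) A = kappa A &
      mutually_independent S].

Definition random_tess (n : nat) (S : 'I_n -> {RV P >-> sconvex R d})
    (w : Omega) : set (set E) :=
  tessellation (fun i => S i w).

Definition uniform_mass (X : set (set E)) (A : set (sconvex R d)) : R :=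
  #|` fset_set (X `&` [set (K : set E) | K in A]) |%:R / #|` fset_set X |%:R.

(* The conditional distribution of [Z] given the random collection [T] is the
   uniform distribution on [Phi T]: the defining identity of a conditional
   distribution is required on all measurable events determined by [T]. *)
Definition uniform_given (T : Omega -> set (set E))
    (Phi : set (set E) -> set (set E)) (Z : {RV P >-> sconvex R d}) : Prop :=
  forall (A : set (sconvex R d)) (B : set (set (set E))),
    measurable A -> measurable (T @^-1` B) ->
    P (Z @^-1` A `&` T @^-1` B) =
    (\int[P]_(w in T @^-1` B) (uniform_mass (Phi (T w)) A)%:E)%E.

Definition typical_face (k n : nat) (S : 'I_n -> {RV P >-> sconvex R d})
    (Z : {RV P >-> sconvex R d}) : Prop :=
  uniform_given (random_tess S) (tess_faces k) Z.

Definition typical_section_cell (m : nat)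
    (S : 'I_m -> {RV P >-> sconvex R d}) (L : sconvex R d)
    (Z : {RV P >-> sconvex R d}) : Prop :=
  uniform_given (fun w => section_tess (random_tess S w) L) id Z.

End RandomTessellation.

(* [kappa_k] is the distribution, as a measure on G_s(d,k), of the intersection
   of d - k independent hyperspheres; the intersection of the empty family is
   the whole sphere, so that [kappa_d] is the point mass at S^d. *)
Definition intersection_distribution (R : realType) (d : nat)
    (kappa : probability (sconvex R d) R) (k : nat)
    (kappa_k : probability (sconvex R d) R) : Prop :=
  exists (dO : measure_display) (Omega : measurableType dO)
    (P : probability Omega R) (S : 'I_(d - k) -> {RV P >-> sconvex R d}),
    iid_hyperspheres kappa S /\
    forall A, measurable A -> kappa_k A =
      P [set w | exists2 L : sconvex R d, (A `&` great_subspheres k) L &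
           sphere R d `&` \bigcap_i (S i w : set _) = L].

(* Main.v *)
Require Import Defs.
From HB Require Import structures.
From mathcomp Require Import all_boot all_order all_algebra finmap.
From mathcomp Require Import all_classical all_reals all_analysis.
From mathcomp Require Import measurable_realfun.
From mathcomp Require Import zify ring lra.

(** For hyperspheres in general position, the k-faces of the tessellation
    generated by S_1, ..., S_n are exactly the cells of the sections of the
    tessellations generated by (S_i), i not in J, by the great subspheres
    L_J = \bigcap_(i in J) S_i, where J runs over the (d-k)-subsets. By
    deletion-restriction, the number of cells of such a section depends only on
    k and n. A uniformly chosen k-face is therefore obtained by choosing J
    uniformly, and then a cell of the section by L_J uniformly. Since
    the S_i are i.i.d., all J contribute equally, L_J has distribution kappa_k
    and is independent of the other n-d+k hyperspheres, and Fubini's theorem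
    gives the formula.

    Measurability in the Borel sigma-field of the Hausdorff distance is reduced
    to the events {K | K meets C}, C closed. For the random cells these events
    are projections, along the compact sphere, of closed conditions, hence
    measurable. A measurable choice of unit normal vectors of the hyperspheres
    describes the cells by sign
    vectors. *)

Set Implicit Arguments.
Unset Strict Implicit.
Unset Printing Implicit Defensive.

Import Order.TTheory GRing.Theory Num.Theory.
Import numFieldNormedType.Exports.

Local Open Scope classical_set_scope.
Local Open Scope ring_scope.

(** The random objects live on unrelated probability spaces, and a tessellation is a bare set-valued
    function of the sample point. Everything is therefore expressed through the finite family of
    hyperspheres, whose law is determined by [kappa] on boxes. This moves an i.i.d. family to a
    product space, where the hyperspheres cutting out the flat and those subdividing it are separate
    coordinates, and Tonelli applies. General position is almost sure by duality: with the other
    hyperspheres fixed, a bad [S_j] must contain a fixed point [x] of the sphere, and the polar of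
    [u] contains [x] exactly when [u] lies in the polar of [x], a [kappa0]-null set. The description
    of faces by sign vectors holds only off this null event; on it the uniform mass is not shown to
    be measurable, so one step works with lower integrals. Projections preserve measurability here
    only for closed conditions. Strict inequalities and non-membership are exhausted by closed
    conditions with slack [1/(p+1)]. The formula is proved for events and extended to [h] by simple
    functions. *)

Section DotTheory.
Context {R : realType} {d : nat}.
Local Notation E := 'rV[R]_d.+1.
Implicit Types (x y z u v : E) (a b : R).

Lemma dotC x y : dot x y = dot y x.
Proof. by apply: eq_bigr => i _; rewrite mulrC. Qed.

Lemma dotDl x y z : dot (x + y) z = dot x z + dot y z.
Proof. by rewrite -big_split/=; apply: eq_bigr => i _; rewrite mxE mulrDl. Qed.

Lemma dotDr x y z : dot x (y + z) = dot x y + dot x z.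
Proof. by rewrite dotC dotDl !(dotC x). Qed.

Lemma dotZl a x y : dot (a *: x) y = a * dot x y.
Proof. by rewrite mulr_sumr; apply: eq_bigr => i _; rewrite mxE mulrA. Qed.

Lemma dotZr a x y : dot x (a *: y) = a * dot x y.
Proof. by rewrite dotC dotZl dotC. Qed.

Lemma dotNl x y : dot (- x) y = - dot x y.
Proof. by rewrite -scaleN1r dotZl mulN1r. Qed.

Lemma dotNr x y : dot x (- y) = - dot x y.
Proof. by rewrite dotC dotNl dotC. Qed.

Lemma dotBl x y z : dot (x - y) z = dot x z - dot y z.
Proof. by rewrite dotDl dotNl. Qed.

Lemma dotBr x y z : dot x (y - z) = dot x y - dot x z.
Proof. by rewrite dotDr dotNr. Qed.

Lemma dot0l x : dot 0 x = 0.
Proof. by rewrite -(scale0r x) dotZl mul0r. Qed.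

Lemma dot0r x : dot x 0 = 0.
Proof. by rewrite dotC dot0l. Qed.

Lemma dot_sumr (I : Type) (s : seq I) (Q : pred I) (F : I -> E) x :
  dot x (\sum_(i <- s | Q i) F i) = \sum_(i <- s | Q i) dot x (F i).
Proof. by apply: (big_morph (dot x)) => [y z|]; rewrite ?dotDr ?dot0r. Qed.

Lemma dot_suml (I : Type) (s : seq I) (Q : pred I) (F : I -> E) x :
  dot (\sum_(i <- s | Q i) F i) x = \sum_(i <- s | Q i) dot (F i) x.
Proof. by rewrite dotC dot_sumr; apply: eq_bigr => i _; rewrite dotC. Qed.

Lemma dot_delta x i : dot x (delta_mx 0 i) = x ord0 i.
Proof.
rewrite /dot (bigD1 i)//= big1 ?mxE ?eqxx ?mulr1 ?addr0// => j ji.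
by rewrite mxE (negbTE ji) andbF mulr0.
Qed.

Lemma dot_ge0 x : 0 <= dot x x.
Proof. by apply: sumr_ge0 => i _; rewrite -expr2 sqr_ge0. Qed.

Lemma dot_eq0 x : (dot x x == 0) = (x == 0).
Proof.
apply/idP/eqP => [|->]; last by rewrite dot0l.
rewrite psumr_eq0 => [/allP x0|i _]; last by rewrite -expr2 sqr_ge0.
apply/matrixP => i j; rewrite ord1 mxE; apply/eqP.
by have := x0 j; rewrite mem_index_enum -expr2 sqrf_eq0; apply.
Qed.

Lemma dot_gt0 x : (0 < dot x x) = (x != 0).
Proof. by rewrite lt_neqAle dot_ge0 andbT eq_sym dot_eq0. Qed.

Lemma coord_le_norm x i : `|x ord0 i| <= `|x|.
Proof.
rewrite [in leRHS]/Num.norm/= mx_normrE.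
exact: (le_bigmax _ (fun ij => `|x ij.1 ij.2|) (ord0, i)).
Qed.

Lemma dot_bound x y : `|dot x y| <= d.+1%:R * (`|x| * `|y|).
Proof.
apply: (le_trans (ler_norm_sum _ _ _)).
rewrite mulr_natl -[X in _ *+ X]card_ord -sumr_const; apply: ler_sum => i _.
by rewrite normrM ler_pM// coord_le_norm.
Qed.

(** The square of the largest coordinate is one of the terms of [dot x x]. Together with [dot_bound]
    this compares the sup norm with the Euclidean structure. *)
Lemma normr_sqr_le_dot x : `|x| ^+ 2 <= dot x x.
Proof.
have [->|x0] := eqVneq x 0; first by rewrite normr0 expr0n/= dot0l.
have /mx_norm_neq0[[i j]/= xE] : mx_norm x != 0.
  by apply: contra_neq x0 => /mx_norm_eq0.
rewrite [X in X ^+ 2]xE real_normK ?num_real// (ord1 i) /dot (bigD1 j)//= -expr2.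
by rewrite lerDl sumr_ge0// => l _; rewrite -expr2 sqr_ge0.
Qed.

Lemma dot_sub_sphere x y : sphere R d x -> sphere R d y ->
  dot (x - y) (x - y) = 2 - 2 * dot x y.
Proof.
by rewrite /sphere/= dotBl !dotBr => -> ->; rewrite (dotC y x); ring.
Qed.

Lemma dot_sphere_itv x y : sphere R d x -> sphere R d y -> -1 <= dot x y <= 1.
Proof.
move=> Sx Sy; have := dot_ge0 (x - y); have := dot_ge0 (x + y).
rewrite (dot_sub_sphere Sx Sy) dotDl !dotDr Sx Sy (dotC y x).
by move=> ? ?; apply/andP; split; lra.
Qed.

Lemma cauchy_schwarz_sphere x y : sphere R d y -> dot x y ^+ 2 <= dot x x.
Proof.
move=> Sy; have := dot_ge0 (x - dot x y *: y).
by rewrite dotBl !dotBr !dotZl !dotZr Sy (dotC y x); nra.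
Qed.

Lemma sphereN x : sphere R d x -> sphere R d (- x).
Proof. by rewrite /sphere/= dotNl dotNr opprK. Qed.

Lemma sphere_neq0 x : sphere R d x -> x != 0.
Proof. by rewrite -dot_eq0 => ->; rewrite oner_eq0. Qed.

Lemma sphere_scale x : x != 0 -> exists2 t : R, 0 < t & sphere R d (t *: x).
Proof.
rewrite -dot_gt0 => x0; exists (Num.sqrt (dot x x))^-1.
  by rewrite invr_gt0 sqrtr_gt0.
rewrite /sphere/= dotZl dotZr mulrA -invfM -expr2 sqr_sqrtr ?dot_ge0//.
by rewrite mulVf// gt_eqF.
Qed.

Lemma dot_cvg (T : Type) (F : set_system T) (FF : Filter F) (f g : T -> E) x y :
  f @ F --> x -> g @ F --> y -> (fun t => dot (f t) (g t)) @ F --> dot x y.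
Proof.
move=> fx gy; apply: (@cvg_big _ _ +%R 0 _ (@add_continuous _)) => i _; apply: cvgM.
  apply: (@cvg_comp _ _ _ f (fun z : E => z ord0 i) _ _ _ fx).
  exact: (@coord_continuous R 1 d.+1).
apply: (@cvg_comp _ _ _ g (fun z : E => z ord0 i) _ _ _ gy).
exact: (@coord_continuous R 1 d.+1).
Qed.

Lemma dot_continuous x : continuous (dot x).
Proof.
move=> y; exact: (@dot_cvg _ (nbhs y) _ (cst x) idfun _ _ (cvg_cst _)).
Qed.

Lemma closed_dot_ge x a : closed [set y | a <= dot x y].
Proof.
rewrite (_ : [set y | _] = dot x @^-1` [set t | a <= t])//.
by apply: preimage_closed (@closed_ge _ _) => y _; exact: dot_continuous.
Qed.

Lemma closed_dot_eq0 x : closed [set y | dot x y = 0].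
Proof.
rewrite (_ : [set y | _] = dot x @^-1` [set 0])//.
by apply: preimage_closed (@closed_eq _ _) => y _; exact: dot_continuous.
Qed.

Lemma sphere_compact : compact (sphere R d).
Proof.
apply: bounded_closed_compact.
  exists 1; split; rewrite ?num_real// => M M1 x /= Sx.
  apply: le_trans (ltW M1); rewrite -(@ler_pXn2r _ 2)// ?nnegrE// expr1n.
  by rewrite -Sx normr_sqr_le_dot.
rewrite (_ : sphere R d = (fun x => dot x x) @^-1` [set 1])//.
apply: preimage_closed (@closed_eq _ _) => x _.
exact: (@dot_cvg _ (nbhs x) _ idfun idfun).
Qed.

Lemma sphere_closed : closed (sphere R d).
Proof. by apply: compact_closed sphere_compact; exact: norm_hausdorff. Qed.

Lemma geodist_itv x y : sphere R d x -> sphere R d y -> 0 <= geodist x y <= pi.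
Proof.
by move=> Sx Sy; have [] := acos_def (dot_sphere_itv Sx Sy).
Qed.

Lemma cos_geodist x y : sphere R d x -> sphere R d y -> cos (geodist x y) = dot x y.
Proof. by move=> Sx Sy; have [] := acos_def (dot_sphere_itv Sx Sy). Qed.

(** On the sphere [dot (x - y) (x - y) = 2 - 2 * cos (geodist x y)], so comparing cosines replaces a
    modulus of continuity for [acos]. *)
Lemma norm_geodist_small (e : R) : 0 < e -> exists2 r : R, 0 < r &
  forall x y, sphere R d x -> sphere R d y -> `|x - y| < r -> geodist x y < e.
Proof.
move=> e0; have [pie|epi] := ltP pi e.
  exists 1 => // x y Sx Sy _; apply: le_lt_trans pie.
  by have /andP[] := geodist_itv Sx Sy.
have ce1 : cos e < 1.
  by rewrite -(@cos0 R) ltr_cos// in_itv/= ?lexx ?pi_ge0// (ltW e0).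
pose c := (1 - cos e) / d.+1%:R.
have c0 : 0 < c by rewrite divr_gt0// subr_gt0.
(* The bound by 1 makes the square of [|x - y|] at most [|x - y|], so a bound linear in the norm
   suffices. *)
exists (Num.min 1 c); first by rewrite lt_min ltr01.
move=> x y Sx Sy; rewrite lt_min => /andP[xy1 xyc].
rewrite -ltr_cos ?in_itv/= ?geodist_itv// ?(ltW e0)//.
rewrite cos_geodist//.
have := dot_bound (x - y) (x - y).
rewrite dot_sub_sphere// => /(le_trans (ler_norm _)).
have : d.+1%:R * `|x - y| < 1 - cos e by rewrite mulrC -ltr_pdivlMr.
have := normr_ge0 (x - y); have := ltr0Sn R d.
move: (`|x - y|) xy1 => t; set D := d.+1%:R => t1 D0 t0 h1 h2.
have : D * (t * t) <= D * t by rewrite ler_pM2l// ler_piMr// ltW.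
by lra.
Qed.

Lemma geodist_norm_small (r : R) : 0 < r -> exists2 e : R, 0 < e &
  forall x y, sphere R d x -> sphere R d y -> geodist x y < e -> `|x - y| < r.
Proof.
(* The squared Euclidean distance will be less than [2 * t <= r ^+ 2]; the bound by 1 keeps [1 - t]
   in the domain of [acos]. *)
move=> r0; pose t := Num.min 1 (r ^+ 2 / 2).
have t0 : 0 < t by rewrite lt_min ltr01 divr_gt0// exprn_gt0.
have t1 : t <= 1 by rewrite ge_min lexx.
have tr : t <= r ^+ 2 / 2 by rewrite ge_min lexx orbT.
have tI : -1 <= 1 - t <= 1 by apply/andP; split; lra.
have [/andP[a0 api] ca] := acos_def tI.
exists (acos (1 - t)); first by rewrite acos_gt0//; apply/andP; split; lra.
move=> x y Sx Sy; rewrite -ltr_cos ?in_itv/= ?geodist_itv ?a0//.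
rewrite ca cos_geodist// => lt.
rewrite -(@ltr_pXn2r _ 2) ?nnegrE ?(ltW r0)//.
apply: (le_lt_trans (normr_sqr_le_dot _)).
by rewrite dot_sub_sphere//; lra.
Qed.

End DotTheory.

(** * Spherically convex sets, Hausdorff distance and hit events *)

Section SconvexTheory.
Context {R : realType} {d : nat}.
Local Notation E := 'rV[R]_d.+1.
Implicit Types (x y z u v : E) (K L : sconvex R d) (C : set E).

Lemma sconvex_inj K L : K = L :> set E -> K = L.
Proof.
case: K L => [K hK] [L hL] /= KL; move: hK hL; rewrite KL => hK hL.
by rewrite (Prop_irrelevance hK hL).
Qed.

Lemma sconvex_sphere K : K `<=` sphere R d.
Proof. by have [C [_ _ _ ->]] := sconvexP K. Qed.

Lemma sconvex_closed K : closed K.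
Proof.
have [C [_ cC _ ->]] := sconvexP K; exact: closedI cC sphere_closed.
Qed.

Lemma sconvex_compact K : compact K.
Proof.
rewrite -(setIidr (@sconvex_sphere K)).
exact: compact_closedI sphere_compact (@sconvex_closed K).
Qed.

Lemma sconvex_nonempty K : (K : set E) !=set0.
Proof.
have [C [[C0 _ CZ] _ C1 ->]] := sconvexP K.
have [x [Cx x0]] : exists x, C x /\ x != 0.
  apply: contrapT => /forallNP C2; apply: C1; apply/seteqP; split => [x Cx|x ->//].
  by apply/eqP/negPn/negP => x0; apply: (C2 x).
by have [t t0 St] := sphere_scale x0; exists (t *: x); split => //; exact: CZ (ltW t0) Cx.
Qed.

Lemma geodist_set_le x y K (e : R) : sphere R d x -> (K : set E) y ->
  geodist x y <= e -> geodist_set x K <= e.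
Proof.
move=> Sx Ky; apply: le_trans; apply: ge_inf; last by exists y.
exists 0 => _ [z Kz <-].
by have /andP[] := geodist_itv Sx (sconvex_sphere Kz).
Qed.

Lemma geodist_set_lt x K (e : R) :
  geodist_set x K < e -> exists2 y, (K : set E) y & geodist x y < e.
Proof.
move=> /inf_lt [|_ [y Ky <-] xy]; last by exists y.
by have [y Ky] := sconvex_nonempty K; exists (geodist x y), y.
Qed.

Lemma hausdorff_dist_le K L (e : R) :
  (forall x, (K : set E) x -> exists2 y, (L : set E) y & geodist x y <= e) ->
  (forall y, (L : set E) y -> exists2 x, (K : set E) x & geodist y x <= e) ->
  hausdorff_dist K L <= e.
Proof.
move=> KL LK; rewrite /hausdorff_dist ge_max; apply/andP; split.
  apply: ge_sup; first by have [x Kx] := sconvex_nonempty K; exists (geodist_set x L), x.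
  move=> _ [x Kx <-]; have [y Ly xy] := KL x Kx.
  exact: geodist_set_le (sconvex_sphere Kx) Ly xy.
apply: ge_sup; first by have [x Lx] := sconvex_nonempty L; exists (geodist_set x K), x.
move=> _ [y Ly <-]; have [x Kx xy] := LK y Ly.
exact: geodist_set_le (sconvex_sphere Ly) Kx xy.
Qed.

Lemma hausdorff_dist_lt K L (e : R) y :
  hausdorff_dist K L < e -> (L : set E) y -> exists2 x, (K : set E) x & geodist y x < e.
Proof.
rewrite /hausdorff_dist gt_max => /andP[_ LK] Ly; apply: geodist_set_lt.
apply: le_lt_trans LK; apply: ub_le_sup; last by exists y.
exists pi => _ [z Lz <-]; have [x Kx] := sconvex_nonempty K.
apply: (geodist_set_le (sconvex_sphere Lz) Kx).
by have /andP[] := geodist_itv (sconvex_sphere Lz) (sconvex_sphere Kx).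
Qed.

(** The hit events of random set theory. Those with [C] closed detect measurability of maps into
    [K_s(d)], see [measurable_fun_hit]. *)
Definition hit C : set (sconvex R d) := [set K | (K : set E) `&` C !=set0].

(** Otherwise points of [A] at distance less than [1/(n+1)] from [B] cluster at a point of [A],
    which lies in the closed set [B]. *)
Lemma compact_disjoint_dist (A B : set E) : compact A -> closed B ->
  A `&` B = set0 -> exists2 r : R, 0 < r & forall x y, A x -> B y -> r <= `|x - y|.
Proof.
move=> cA cB AB0; apply: contrapT => H.
have H1 : forall r : R, 0 < r -> exists x y, [/\ A x, B y & `|x - y| < r].
  move=> r r0; apply: contrapT => H1; apply: H; exists r => // x y Ax By.
  by rewrite leNgt; apply/negP => xy; apply: H1; exists x, y.
pose G (n : nat) x := exists2 y, B y & `|x - y| < n.+1%:R^-1.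
have /choice[f fP] n : exists x, A x /\ G n x.
  have [|x [y [Ax By xy]]] := H1 n.+1%:R^-1; first by rewrite invr_gt0.
  by exists x; split => //; exists y.
have fA : (f @ \oo) A by exists 0%N => // n _; exact: (fP n).1.
have [x [Ax clx]] := cA (f @ \oo) _ fA.
suff Bx : B x by have : (A `&` B) x by []; rewrite AB0.
apply: cB => U /nbhs_ballP[e /= e0 xeU].
have e20 : 0 < e / 2 by rewrite divr_gt0.
have [n _ nP] := near_infty_natSinv_lt (PosNum e20).
have : (f @ \oo) [set z | exists2 m, (n <= m)%N & z = f m].
  by exists n => // m /= nm; exists m.
move=> /clx /(_ (nbhsx_ballx x _ e20)) [z [[m nm ->] xfm]].
have [_ [y By fy]] := fP m; exists y; split => //; apply: xeU.
rewrite -ball_normE/= in xfm *.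
rewrite -(subrKA (f m)) (splitr e); apply: (le_lt_trans (ler_normD _ _)).
by rewrite ltrD// (lt_trans fy)// nP.
Qed.

(** The complement is Hausdorff-open: a set missing [C] has positive distance to it, and every point
    of a Hausdorff-close set is close to the given one. *)
Lemma measurable_hit C : closed C -> measurable (hit C).
Proof.
move=> cC; rewrite -(setCK (hit C)); apply: measurableC.
apply: sub_sigma_algebra => K /= KC.
have [r r0 rP] : exists2 r : R, 0 < r &
    forall x y, (K : set E) x -> C y -> r <= `|x - y|.
  apply: compact_disjoint_dist => //; first exact: sconvex_compact.
  by apply/seteqP; split => // x KCx; apply: KC; exists x.
have [e e0 eP] := @geodist_norm_small R d r r0.
exists e => // L KL [y [Ly Cy]].
have [x Kx yx] := hausdorff_dist_lt KL Ly.
have := eP y x (sconvex_sphere Ly) (sconvex_sphere Kx) yx.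
by rewrite distrC ltNge rP.
Qed.

Lemma measurable_hit1 x : measurable (hit [set x]).
Proof.
apply: measurable_hit; exact: accessible_closed_set1 (hausdorff_accessible (@norm_hausdorff _ _)) _.
Qed.

End SconvexTheory.

(** * Countable dense sequences in compact sets *)

Section Density.
Context {R : realType} {d : nat}.
Local Notation E := 'rV[R]_d.+1.

Lemma closed_norm_ball (q : E) (r : R) : closed [set x : E | `|q - x| <= r].
Proof.
rewrite (_ : [set x | _] = (fun x : E => `|q - x|) @^-1` [set t | t <= r])//.
apply: preimage_closed (@closed_le _ _) => x _.
by apply: (@cvg_norm _ _ _ (nbhs x)); apply: (@cvgB _ _ _ (nbhs x)); [exact: cvg_cst|exact: cvg_id].
Qed.

Lemma open_norm_ball (q : E) (r : R) : open [set x : E | `|q - x| < r].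
Proof.
rewrite (_ : [set x | _] = (fun x : E => `|q - x|) @^-1` [set t | t < r])//.
apply: open_comp (@open_lt _ _) => x _.
by apply: (@cvg_norm _ _ _ (nbhs x)); apply: (@cvgB _ _ _ (nbhs x)); [exact: cvg_cst|exact: cvg_id].
Qed.

Lemma compact_dense_seq (Q : set E) : compact Q -> Q !=set0 ->
  exists q : nat -> E, (forall n, Q (q n)) /\
    forall x e, Q x -> 0 < e -> exists n, `|q n - x| < e.
Proof.
move=> cQ [x0 Qx0].
have /choice[s sP] p : exists s : seq E, (forall x, x \in s -> Q x) /\
    forall x, Q x -> exists2 q, q \in s & `|q - x| < p.+1%:R^-1.
  move: cQ; rewrite compact_cover.
  move=> /(_ _ Q (fun q => [set x | `|q - x| < p.+1%:R^-1])) [].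
  - by move=> q _; exact: open_norm_ball.
  - by move=> x Qx; exists x => //=; rewrite subrr normr0.
  - move=> D DQ QD; exists (enum_fset D); split => [x xD|x /QD[q qD xq]].
      by have := DQ _ xD; rewrite inE.
    by exists q.
(* The index codes a pair [(p, i)]: the [i]-th centre of a finite net of mesh [1/(p+1)], with
   default value [x0]. *)
exists (fun n => if @choice.unpickle (nat * nat)%type n is Some (p, i) then nth x0 (s p) i else x0).
split => [n|x e Qx e0].
  case: (@choice.unpickle (nat * nat)%type n) => // -[p i]; have [isp|spi] := ltnP i (size (s p)).
    by apply: (sP p).1; exact: mem_nth.
  by rewrite nth_default.
have [p _ pe] := near_infty_natSinv_lt (PosNum e0).
have [q qs qx] := (sP p).2 x Qx.
exists (choice.pickle (p, index q (s p))); rewrite choice.pickleK nth_index//.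
by rewrite (lt_trans qx)// pe//=.
Qed.

End Density.

(** * Measurability criteria: hit events and projections along compact sets *)

Section Criterion.
Context {R : realType} {d : nat}.
Local Notation E := 'rV[R]_d.+1.
Implicit Types (K L : sconvex R d) (C : set E).

(** Every Hausdorff-open set is a countable union of sets [V c], each saying that the balls of a
    finite list are all hit and together cover the set. Such a condition is a finite combination of
    hit events. *)
Lemma measurable_fun_hit (dY : measure_display) (Y : measurableType dY)
    (D : set Y) (phi : Y -> sconvex R d) :
  (forall C, closed C -> measurable (D `&` phi @^-1` hit C)) ->
  measurable_fun D phi.
Proof.
move=> mphi.
have mD : measurable D.
  rewrite (_ : D = D `&` phi @^-1` hit setT); first exact/mphi/closedT.
  apply/seteqP; split => [y Dy|y []//]; split => //.
  by have [x Kx] := sconvex_nonempty (phi y); exists x.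
apply: (measurability (@hausdorff_open R d)) => // _ [U oU <-].
have [q [qS qP]] := compact_dense_seq (@sphere_compact R d)
  (ex_intro _ _ (sphere_nonempty (R := R) (d := d))).
(* Closed balls serve for hitting and open balls for covering, so that the closed balls and the
   complement of the covered region are all closed sets. *)
pose B (m : nat) (i : nat) := [set x : E | `|q i - x| < m.+1%:R^-1].
pose cB (m : nat) (i : nat) := [set x : E | `|q i - x| <= m.+1%:R^-1].
pose V (c : {fset nat} * nat) : set (sconvex R d) :=
  [set K | (forall i, i \in c.1 -> hit (cB c.2 i) K) /\
    ~ hit (~` (\bigcup_(i in [set` c.1]) B c.2 i)) K].
have mV c : measurable (D `&` phi @^-1` V c).
  rewrite (_ : _ `&` _ = (D `&` \bigcap_(i in [set` c.1])
      (D `&` phi @^-1` hit (cB c.2 i))) `\`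
      (D `&` phi @^-1` hit (~` (\bigcup_(i in [set` c.1]) B c.2 i)))).
    apply: measurableD.
      have -> : D `&` \bigcap_(i in [set` c.1]) (D `&` phi @^-1` hit (cB c.2 i)) =
         \bigcap_(i in setT) (if i \in c.1 then D `&` phi @^-1` hit (cB c.2 i) else D).
        apply/seteqP; split => [y [Dy H] i _|y H].
          by case: ifP => // ic; exact: H.
        have Dy : D y by have := H 0%N I; case: ifP => // _ [].
        by split => // i /= ic; have := H i I; rewrite ic.
      apply: bigcapT_measurable => i; case: ifP => // _.
      by apply: mphi; exact: closed_norm_ball.
    apply: mphi; apply: open_closedC; apply: bigcup_open => i _.
    exact: open_norm_ball.
  apply/seteqP; split => [y [Dy [H1 H2]]|y [[Dy H1] H2]].
    by split => [|[_ //]]; split => // i ic; split => //; exact: H1.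
  split => //; split => [i ic|H3]; first by have [] := H1 i ic.
  exact: H2.
rewrite (_ : _ `&` _ = \bigcup_(n in setT) (if choice.unpickle n is Some c then
   if `[< V c `<=` U >] then D `&` phi @^-1` V c else set0 else set0)).
  apply: bigcupT_measurable => n; case: (choice.unpickle n) => // c.
  by case: ifP => // _; exact: mV.
apply/seteqP; split => [y [Dy Uy]|y [n _]]; last first.
  case: (choice.unpickle n) => // c; case: ifP => // /asboolP VU [Dy Vy].
  by split => //; exact: VU.
have [e e0 eU] := oU _ Uy.
(* Half of [e] is taken because [hausdorff_dist_le] gives only a weak inequality; below, half of [r]
   bounds the radius since two points near the same centre are compared. *)
have [r r0 rP] := @norm_geodist_small R d (e / 2) ltac:(by rewrite divr_gt0).
have r20 : 0 < r / 2 by rewrite divr_gt0.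
have [m _ /(_ m (leqnn m))/= mr] := near_infty_natSinv_lt (PosNum r20).
have Sx := @sconvex_sphere R d.
have := @sconvex_compact R d (phi y); rewrite compact_cover.
(* Only balls that meet [phi y] enter the cover, so the finite subcover satisfies both conditions of
   [V]. *)
move=> /(_ _ [set i | hit (B m i) (phi y)] (B m)) [].
- by move=> i _; exact: open_norm_ball.
- move=> x Kx; have [i qix] := qP x m.+1%:R^-1 (Sx _ _ Kx) ltac:(by rewrite invr_gt0).
  by exists i => //; exists x.
move=> c cD cov; exists (choice.pickle (c, m)) => //; rewrite choice.pickleK.
have near_dist x z i : `|q i - x| < m.+1%:R^-1 -> `|q i - z| <= m.+1%:R^-1 ->
    `|x - z| < r.
  move=> xi zi; rewrite -(subrKA (q i)) (splitr r) (le_lt_trans (ler_normD _ _))//.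
  by rewrite ltrD//; [rewrite distrC (lt_trans xi)|rewrite (le_lt_trans zi)].
have -> : `[< V (c, m) `<=` U >].
  apply/asboolP => L [/= VL1 VL2]; apply: eU.
  apply: (@le_lt_trans _ _ (e / 2)); last by rewrite ltr_pdivrMr// ltr_pMr// ltr1n.
  apply: hausdorff_dist_le => [x Kx|z Lz].
    have [i ic /= qix] := cov x Kx.
    have [z [Lz /= qiz]] := VL1 i ic; exists z => //; apply/ltW/rP; first exact: Sx Kx.
      exact: Sx Lz.
    exact: near_dist qix qiz.
  have [i /= ic qiz] : (\bigcup_(i in [set` c]) B m i) z.
    by apply: contrapT => Bz; apply: VL2; exists z.
  have := cD _ ic; rewrite inE => -[x [Kx /= qix]].
  exists x => //; apply/ltW/rP; [exact: Sx Lz|exact: Sx Kx|].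
  exact: near_dist qiz (ltW qix).
split => //; split => /= [i ic|].
  have := cD _ ic; rewrite inE => -[x [Kx /= qix]].
  by exists x; split => //=; exact: ltW.
by move=> [x [Kx]]; apply; have [i ic ix] := cov x Kx; exists i.
Qed.

(* Since [Q] is compact and [g y] continuous, [g y <= 0] has a solution in [Q]
   as soon as [g y < 1/p] has one, for every [p], in a countable dense set. *)
Lemma measurable_proj (dY : measure_display) (Y : measurableType dY)
    (Q : set E) (g : Y -> E -> R) :
  compact Q -> (forall y, continuous (g y)) ->
  (forall z, measurable_fun setT (g ^~ z)) ->
  measurable [set y | exists2 z, Q z & g y z <= 0].
Proof.
move=> cQ cg mg; have [[x0 Qx0]|/set0P/negP/negPn/eqP Q0] := pselect (Q !=set0); last first.
  rewrite (_ : [set y | _] = set0)//.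
  by apply/seteqP; split => // y [z]; rewrite Q0.
have [q [qQ qP]] := compact_dense_seq cQ (ex_intro _ _ Qx0).
rewrite (_ : [set y | _] = \bigcap_(p in setT) \bigcup_(n in setT)
    ((g ^~ (q n)) @^-1` [set t | t < p.+1%:R^-1])); last first.
  apply/seteqP; split => [y [z Qz gz] p _|y H].
    have gzp : g y z < p.+1%:R^-1 by rewrite (le_lt_trans gz)// invr_gt0.
    have : \forall x \near z, g y x < p.+1%:R^-1.
      by have := cg y z; move=> /(_ _ (lt_nbhsl gzp)).
    move=> /nbhs_ballP[e /= e0 eP]; have [n qn] := qP z e Qz e0.
    by exists n => //; apply: eP; rewrite -ball_normE/= distrC.
  have [z [Qz zmin]] : exists z, Q z /\ forall x, Q x -> g y z <= g y x.
    have [|z Qz zP] := @EVT_min_rV _ _ (g y) Q (ex_intro _ _ Qx0) cQ.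
      exact: continuous_subspaceT.
    by exists z; split => [|x Qx]; [rewrite inE in Qz|apply: zP; rewrite inE].
  exists z => //; rewrite leNgt; apply/negP => gz.
  have [p _ /(_ p (leqnn p))/= pg] := near_infty_natSinv_lt (PosNum gz).
  have [n _ /=] := H p I; rewrite ltNge => /negP; apply.
  by rewrite (le_trans (ltW pg))// zmin.
apply: bigcapT_measurable => p; apply: bigcupT_measurable => n.
rewrite -[X in measurable X]setTI; apply: mg => //.
by rewrite -set_itvNyo; exact: measurable_itv.
Qed.

End Criterion.

(** * Distance and support functions on [K_s(d)] *)

Section DistanceSupport.
Context {R : realType} {d : nat}.
Local Notation E := 'rV[R]_d.+1.
Implicit Types (K L : sconvex R d) (x y z : E).

(** As [K] is closed, membership becomes the inequality [dist_to K x <= 0], continuous in [x] and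
    measurable in [K]: the form required for projections. *)
Definition dist_to K x : R := inf [set `|x - y| | y in (K : set E)].

(** The support function, from which a normal vector of a hypersphere is recovered measurably. *)
Definition supp K x : R := sup [set dot x y | y in (K : set E)].

Let norm_sub_continuous x : continuous (fun y : E => `|x - y|).
Proof.
move=> y; apply: (@cvg_norm _ _ _ (nbhs y)).
by apply: (@cvgB _ _ _ (nbhs y)); [exact: cvg_cst|exact: cvg_id].
Qed.

Lemma dist_to_attained K x : exists2 y, (K : set E) y & dist_to K x = `|x - y|.
Proof.
have [|y /set_mem Ky ymin] := @EVT_min_rV _ _ (fun y => `|x - y|) K
  (sconvex_nonempty K) (@sconvex_compact _ _ K).
  exact: continuous_subspaceT.
exists y => //; apply/eqP; rewrite eq_le; apply/andP; split.
  by apply: ge_inf; [exists 0 => _ [z _ <-]|exists y].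
apply: lb_le_inf; first by exists `|x - y|, y.
by move=> _ [z Kz <-]; apply: ymin; rewrite inE.
Qed.

Lemma dist_to_le K x y : (K : set E) y -> dist_to K x <= `|x - y|.
Proof. by move=> Ky; apply: ge_inf; [exists 0 => _ [z _ <-]|exists y]. Qed.

Lemma dist_to_le0 K x : (dist_to K x <= 0) = `[< (K : set E) x >].
Proof.
apply/idP/asboolP => [|Kx]; last by rewrite (le_trans (dist_to_le _ Kx))// subrr normr0.
have [y Ky ->] := dist_to_attained K x.
by rewrite normr_le0 subr_eq0 => /eqP ->.
Qed.

Lemma dist_to_continuous K : continuous (dist_to K).
Proof.
have lip x z : dist_to K x - dist_to K z <= `|x - z|.
  have [y Ky ->] := dist_to_attained K z.
  rewrite lerBlDr (le_trans (dist_to_le _ Ky))//.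
  by rewrite -(subrKA z) ler_normD.
move=> x; apply/(@cvgrPdist_lt _ _ _ (nbhs x)) => e e0; near=> z.
apply: (@le_lt_trans _ _ `|x - z|).
  by rewrite ler_norml lerNl opprB lip distrC lip.
near: z; apply/nbhs_ballP; exists e => //= z; rewrite -ball_normE.
Unshelve. all: by end_near. Qed.

(** The minimum is attained, so sublevel sets of the distance are hit events of closed balls. The
    sign is reversed because the generating intervals are unbounded above. *)
Lemma measurable_dist_to x : measurable_fun setT (dist_to ^~ x).
Proof.
suff mN : measurable_fun setT (fun K => - dist_to K x).
  have -> : dist_to ^~ x = (fun K => - - dist_to K x) by apply/funext => K; rewrite opprK.
  exact: measurableT_comp.
apply: (measurability _ (RGenCInfty.measurableE R)) => _ [_ [a ->] <-].
rewrite setTI (_ : _ @^-1` _ = @hit R d [set y | `|x - y| <= - a]).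
  by apply: measurable_hit; exact: closed_norm_ball.
apply/seteqP; split => K /=; rewrite in_itv/= andbT lerNr.
  by have [y Ky ->] := dist_to_attained K x; exists y.
by move=> [y [Ky /=]]; apply: le_trans; exact: dist_to_le.
Qed.

Lemma supp_attained K x : exists2 y, (K : set E) y & supp K x = dot x y.
Proof.
have [|y /set_mem Ky ymax] := @EVT_max_rV _ _ (dot x) K
  (sconvex_nonempty K) (@sconvex_compact _ _ K).
  exact/continuous_subspaceT/dot_continuous.
exists y => //; apply/eqP; rewrite eq_le; apply/andP; split.
  apply: ge_sup; first by exists (dot x y), y.
  by move=> _ [z Kz <-]; apply: ymax; rewrite inE.
apply: ub_le_sup; last by exists y.
by exists (dot x y) => _ [z Kz <-]; apply: ymax; rewrite inE.
Qed.

Lemma supp_ge K x y : (K : set E) y -> dot x y <= supp K x.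
Proof.
move=> Ky; apply: ub_le_sup; last by exists y.
exists (d.+1%:R * (`|x| * 1)) => _ [z /sconvex_sphere Sz <-].
apply: (le_trans (ler_norm _)); apply: (le_trans (dot_bound _ _)).
rewrite ler_wpM2l// ler_wpM2l// -(@ler_pXn2r _ 2)// ?nnegrE// expr1n.
by rewrite -Sz normr_sqr_le_dot.
Qed.

Lemma measurable_supp x : measurable_fun setT (supp ^~ x).
Proof.
apply: (measurability _ (RGenCInfty.measurableE R)) => _ [_ [a ->] <-].
rewrite setTI (_ : _ @^-1` _ = @hit R d [set y | a <= dot x y]).
  by apply: measurable_hit; exact: closed_dot_ge.
apply/seteqP; split => K /=; rewrite in_itv/= andbT.
  by have [y Ky ->] := supp_attained K x; exists y.
by move=> [y [Ky /=]] /le_trans; apply; exact: supp_ge.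
Qed.

(** The maximum of [dot x] over unit vectors orthogonal to [u] is the length of the projection [z]
    of [x], attained at the normalization of [z] when [z] is nonzero. *)
Lemma supp_polar K u x : sphere R d u -> (K : set E) = polar_hypersphere u ->
  supp K x ^+ 2 = dot x x - dot x u ^+ 2.
Proof.
move=> Su KE; pose z := x - dot x u *: u.
have zu : dot u z = 0 by rewrite dotBr dotZr Su mulr1 dotC subrr.
have zx : dot x z = dot x x - dot x u ^+ 2.
  by rewrite dotBr dotZr expr2.
have zz : dot z z = dot x x - dot x u ^+ 2.
  by rewrite {1}/z dotBl dotZl zu mulr0 subr0.
have xy y : dot u y = 0 -> dot x y = dot z y.
  by move=> uy; rewrite /z dotBl dotZl uy mulr0 subr0.
have [y] := supp_attained K x; rewrite {1}KE => -[/= uy Sy] xyE.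
apply/eqP; rewrite eq_le; apply/andP; split.
  by rewrite xyE xy// -zz cauchy_schwarz_sphere.
have [z0|z0] := eqVneq z 0; first by rewrite -zx z0 dot0r sqr_ge0.
have [t t0 St] := sphere_scale z0.
have : t * (dot x x - dot x u ^+ 2) <= supp K x.
  by rewrite -zx -dotZr; apply: supp_ge; rewrite KE; split => //=; rewrite dotZr zu mulr0.
move=> H.
have : (t * (dot x x - dot x u ^+ 2)) ^+ 2 <= supp K x ^+ 2.
  by rewrite ler_pXn2r// nnegrE ?(le_trans _ H)// -zz mulr_ge0 ?dot_ge0// ltW.
apply: le_trans; rewrite -zz exprMn.
have : dot (t *: z) (t *: z) = 1 by [].
by rewrite dotZl dotZr mulrA -expr2 => tt; rewrite [leRHS]mulrA tt mul1r.
Qed.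

End DistanceSupport.

(** * A measurable choice of normal vectors *)

Section NormalVector.
Context {R : realType} {d : nat}.
Local Notation E := 'rV[R]_d.+1.
Implicit Types (K L : sconvex R d) (x y z u : E).

Let nrm2 K x : R := dot x x - supp K x ^+ 2.

(* If [K = polar_hypersphere u] then [nrm2 K x = dot x u ^+ 2], so that
   polarization recovers the products [u_i * u_j], which do not depend on the
   sign of [u]. *)
Let cross K (i j : 'I_d.+1) : R :=
  let e k : E := delta_mx 0 k in
  (nrm2 K (e i + e j) - nrm2 K (e i) - nrm2 K (e j)) / 2.

Let pivot K (i : 'I_d.+1) : bool :=
  (cross K i i != 0) && [forall l : 'I_d.+1, (l < i)%N ==> (cross K l l == 0)].

(** For the polar of [u] this is the row of the matrix of products [u_i * u_j] at the first index
    with [u_i] nonzero, that is [u_i *: u]. The result is unchanged under [u] to [- u] and need not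
    be a unit vector. *)
Definition normal_vec K : E :=
  \row_j \sum_(i < d.+1) (pivot K i)%:R * cross K i j.

Lemma crossE K u i j : sphere R d u -> (K : set E) = polar_hypersphere u ->
  cross K i j = u ord0 i * u ord0 j.
Proof.
move=> Su KE; have E x : nrm2 K x = dot x u ^+ 2.
  by rewrite /nrm2 (supp_polar _ Su KE) subKr.
rewrite /cross !E dotDl !(dotC _ u) !dot_delta.
by field.
Qed.

Lemma normal_vecE K u : sphere R d u -> (K : set E) = polar_hypersphere u ->
  exists2 c : R, c != 0 & normal_vec K = c *: u.
Proof.
move=> Su KE; have cE := crossE _ _ Su KE.
have [i0 ui0 imin] : exists2 i : 'I_d.+1, u ord0 i != 0 &
    forall l : 'I_d.+1, (l < i)%N -> u ord0 l = 0.
  have /existsP[i0 i0P] : [exists i : 'I_d.+1, u ord0 i != 0].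
    apply: contraT; rewrite negb_exists => /forallP u0.
    apply: (contraNT _ (sphere_neq0 Su)) => _.
    by apply/eqP/matrixP => k i; rewrite ord1 mxE; apply/eqP; have := u0 i; rewrite negbK.
  have [i iP imin] := @arg_minnP _ i0 (fun i => u ord0 i != 0) (fun i : 'I_d.+1 => val i) i0P.
  exists i => // l li; apply/eqP; apply: contraLR li => /imin.
  by rewrite -leqNgt.
exists (u ord0 i0) => //; apply/matrixP => k j; rewrite ord1 !mxE.
have pi0 : pivot K i0.
  rewrite /pivot cE mulf_neq0//=; apply/forallP => l; apply/implyP => li.
  by rewrite cE imin// mul0r.
rewrite (bigD1 i0)//= pi0 mul1r cE big1 ?addr0// => i ii0.
case: (boolP (pivot K i)) => [|_]; last by rewrite mul0r.
rewrite /pivot cE => /andP[ui /forallP iP].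
have [li|li|/val_inj li] := ltngtP i i0; last by rewrite li eqxx in ii0.
  by rewrite imin// mul0r eqxx in ui.
by have := iP i0; rewrite li cE mulf_eq0 (negbTE ui0).
Qed.

Let measurable_cross i j : measurable_fun setT (fun K => cross K i j).
Proof.
have mn x : measurable_fun setT (nrm2 ^~ x).
  apply: measurable_funB; first exact: measurable_cst.
  by apply: measurable_funX; exact: measurable_supp.
rewrite /cross; apply: measurable_funM; last exact: measurable_cst.
apply: measurable_funB; last exact: mn.
by apply: measurable_funB; exact: mn.
Qed.

Let measurable_cross_eq0 i : measurable [set K | cross K i i = 0].
Proof.
have := @measurable_cross i i measurableT _ (measurable_set1 (0 : R)).
by rewrite setTI.
Qed.

Lemma measurable_normal_vec j : measurable_fun setT (fun K => normal_vec K ord0 j).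
Proof.
have -> : (fun K => normal_vec K ord0 j) =
    (fun K => \sum_(i < d.+1) (pivot K i)%:R * cross K i j).
  by apply/funext => K; rewrite mxE.
apply: measurable_sum => i; apply: measurable_funM; last exact: measurable_cross.
have -> : (fun K => (pivot K i)%:R) = \1_[set K | pivot K i] :> (_ -> R).
  by apply/funext => K; rewrite indicE mem_setE.
apply: measurable_indic.
rewrite (_ : [set K | _] = \bigcap_(l in setT)
   (if l == i then ~` [set K | cross K i i = 0] else
    if (l < i)%N then [set K | cross K l l = 0] else setT)).
  apply: fin_bigcap_measurable => [|l _]; first exact: finite_finset.
  case: ifP => _; first by apply: measurableC; exact: measurable_cross_eq0.
  by case: ifP => _ //; exact: measurable_cross_eq0.
apply/seteqP; split => [K /= /andP[ci /forallP cl] l _|K /= H].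
  case: ifP => [_|li]; first exact/eqP.
  by case: ifP => // lti; have := cl l; rewrite lti => /eqP.
apply/andP; split; first by have := H i I; rewrite eqxx => /eqP.
apply/forallP => l; apply/implyP => li; apply/eqP.
by have := H l I; rewrite -val_eqE/= ltn_eqF// li.
Qed.

Lemma measurable_dot_normal_vec x : measurable_fun setT (fun K => dot (normal_vec K) x).
Proof.
apply: measurable_sum => i; apply: measurable_funM; last exact: measurable_cst.
exact: measurable_normal_vec.
Qed.

End NormalVector.

(** * Open and closed polyhedral cones and their traces on the sphere *)

Section Cones.
Context {R : realType} {d : nat}.
Local Notation E := 'rV[R]_d.+1.
Implicit Types (x y z u : E).

Definition ocone (I : Type) (v : I -> E) : set E := [set x | forall j, 0 < dot (v j) x].

Definition ccone (I : Type) (v : I -> E) : set E := [set x | forall j, 0 <= dot (v j) x].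

(** The sign vector [e] is [true] where [dot (w j)] is to be negative, so that all sign conditions
    become positivity. *)
Definition flip (I : Type) (w : I -> E) (e : I -> bool) (j : I) : E := (-1) ^+ e j *: w j.

Lemma dot_flip (I : Type) (w : I -> E) (e : I -> bool) j x :
  dot (flip w e j) x = (-1) ^+ e j * dot (w j) x.
Proof. exact: dotZl. Qed.

Lemma flip_neq0 (I : Type) (w : I -> E) (e : I -> bool) j : w j != 0 -> flip w e j != 0.
Proof. by move=> wj; rewrite scaler_eq0 signr_eq0. Qed.

Lemma flip_ocone (I : finType) (w : I -> E) x : (forall j, dot (w j) x != 0) ->
  ocone (flip w [ffun j => dot (w j) x < 0]) x.
Proof.
move=> wx j; rewrite dot_flip ffunE; have := wx j.
case: (ltrP (dot (w j) x) 0) => H wj0; rewrite ?expr1 ?expr0 ?mulN1r ?mul1r ?oppr_gt0//.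
by rewrite lt_neqAle eq_sym wj0 H.
Qed.

(** One of the two systems need only be weak: an interior point of one cell already excludes every
    other closed cell. *)
Lemma flip_inj (I : finType) (w : I -> E) (e e' : {ffun I -> bool}) x :
  ocone (flip w e) x -> ccone (flip w e') x -> e = e'.
Proof.
move=> ex e'x; apply/ffunP => j; have := ex j; have := e'x j.
rewrite !dot_flip; case: (e j) (e' j) => -[]//; rewrite ?expr1 ?expr0; lra.
Qed.

Lemma ocone_ccone (I : Type) (v : I -> E) : ocone v `<=` ccone v.
Proof. by move=> x vx j; exact/ltW/vx. Qed.

Lemma ocone_add (I : Type) (v : I -> E) x y : ocone v x -> ccone v y -> ocone v (x + y).
Proof. by move=> vx vy j; rewrite dotDr ltr_wpDr. Qed.

Lemma oconeZ (I : Type) (v : I -> E) (t : R) x : 0 < t -> ocone v (t *: x) <-> ocone v x.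
Proof.
by move=> t0; split => vx j; have := vx j; rewrite dotZr pmulr_rgt0.
Qed.

Lemma cconeZ (I : Type) (v : I -> E) (t : R) x : 0 < t -> ccone v (t *: x) <-> ccone v x.
Proof.
by move=> t0; split => vx j; have := vx j; rewrite dotZr pmulr_rge0.
Qed.

Lemma affine_pos (I : finType) (a b : I -> R) : (forall j, 0 < a j) ->
  exists2 t : R, 0 < t & forall s, 0 <= s <= t -> forall j, 0 < a j + s * b j.
Proof.
(* The summand 1 keeps the denominator positive when [b j] vanishes. *)
move=> a0; pose t := \big[Num.min/1]_j (a j / (`|b j| + 1)).
have t0 : 0 < t.
  by apply: lt_bigmin => // j _; rewrite divr_gt0// ltr_wpDl.
exists t => // s /andP[s0 st] j.
have : s <= a j / (`|b j| + 1) by rewrite (le_trans st)//; exact: bigmin_le.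
have b1 : 0 < `|b j| + 1 by rewrite ltr_wpDl.
rewrite ler_pdivlMr// => sb.
have : - (s * b j) <= s * `|b j|.
  by rewrite -mulrN ler_wpM2l// -normrN ler_norm.
have [->|s1] := eqVneq s 0; first by rewrite mul0r addr0.
have : 0 < s by rewrite lt_neqAle eq_sym s1.
have := normr_ge0 (b j); nra.
Qed.

Lemma ocone_perturb (I : finType) (v : I -> E) x y : ocone v x ->
  exists2 t : R, 0 < t & forall s, 0 <= s <= t -> ocone v (x + s *: y).
Proof.
move=> vx; have [t t0 tP] := @affine_pos I (fun j => dot (v j) x) (fun j => dot (v j) y) vx.
by exists t => // s st j; rewrite dotDr dotZr; exact: tP.
Qed.

Lemma ccone_closed (I : Type) (v : I -> E) : closed (ccone v).
Proof.
rewrite (_ : ccone v = \bigcap_(j in setT) [set x | 0 <= dot (v j) x]).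
  by apply: closed_bigI => j _; exact: closed_dot_ge.
by apply/seteqP; split => x vx j; [move=> _|]; apply: vx.
Qed.

Lemma ocone_near (I : finType) (v : I -> E) x : ocone v x -> \forall y \near x, ocone v y.
Proof.
move=> vx; apply: (@filter_forall E I _ (nbhs x) _) => j.
by have := @dot_continuous _ _ (v j) x; move=> /(_ _ (lt_nbhsr (vx j))).
Qed.

Definition normalize x : E := (Num.sqrt (dot x x))^-1 *: x.

Lemma normalize_sphere x : x != 0 -> sphere R d (normalize x).
Proof.
rewrite -dot_gt0 => x0; rewrite /sphere/= dotZl dotZr mulrA -invfM -expr2.
by rewrite sqr_sqrtr ?dot_ge0// mulVf// gt_eqF.
Qed.

Lemma normalize_id x : sphere R d x -> normalize x = x.
Proof. by rewrite /normalize => ->; rewrite sqrtr1 invr1 scale1r. Qed.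

Lemma normalize_coef x : x != 0 -> 0 < (Num.sqrt (dot x x))^-1.
Proof. by rewrite invr_gt0 sqrtr_gt0 dot_gt0. Qed.

Lemma normalize_cvg (T : Type) (F : set_system T) (FF : Filter F) (f : T -> E) x :
  x != 0 -> f @ F --> x -> (fun t => normalize (f t)) @ F --> normalize x.
Proof.
move=> x0 fx; apply: cvgZ => //; apply: cvgV.
  by rewrite sqrtr_eq0 -ltNge dot_gt0.
apply: (@cvg_comp _ _ _ (fun t => dot (f t) (f t)) Num.sqrt _ (nbhs (dot x x))).
  exact: dot_cvg.
exact: sqrt_continuous.
Qed.

Lemma ocone_neq0 (I : Type) (v : I -> E) x (j : I) : ocone v x -> x != 0.
Proof. by move=> vx; apply: contraTneq (vx j) => ->; rewrite dot0r ltxx. Qed.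

Lemma line_cvg x y : (fun s : R => x + s *: y) @ (0 : R)^'+ --> x.
Proof.
have -> : nbhs x = nbhs (x + 0 *: y) by rewrite scale0r addr0.
apply: (@cvgD _ E); first exact: cvg_cst.
apply: (@cvgZr_tmp _ E); apply: cvg_at_right_filter; exact: cvg_id.
Qed.

Lemma normalize_line_cvg x y : sphere R d x ->
  (fun s : R => normalize (x + s *: y)) @ (0 : R)^'+ --> x.
Proof.
move=> Sx.
have := @normalize_cvg _ _ (at_right_proper_filter 0) _ _ (sphere_neq0 Sx) (@line_cvg x y).
by rewrite normalize_id.
Qed.

(** A point [y] of the closed cone is the limit of the normalizations of [y + s *: x] as [s]
    decreases to 0, with [x] an interior point. The index [i0] ensures that vectors of the open cone
    are nonzero. *)
Lemma closure_ocone (I : finType) (v : I -> E) (i0 : I) x :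
  ocone v x -> closure (ocone v `&` sphere R d) = ccone v `&` sphere R d.
Proof.
move=> vx; apply/seteqP; split.
  apply: (@subset_trans _ (closure (ccone v `&` sphere R d))).
    by apply: closure_subset => y [vy Sy]; split => //; exact: ocone_ccone.
  rewrite -(closure_id _).1//; apply: closedI; [exact: ccone_closed|exact: sphere_closed].
move=> y [vy Sy] U yU.
have : (fun s : R => normalize (y + s *: x)) @ (0 : R)^'+ --> y.
  exact: normalize_line_cvg.
move=> /(_ _ yU) [e /= e0 eU].
have [e20 e2e] : 0 < e / 2 /\ e / 2 < e by move: e0 => /= e0; split; lra.
have oc : ocone v (y + (e / 2) *: x).
  by rewrite addrC; apply: ocone_add => //; apply/oconeZ.
exists (normalize (y + (e / 2) *: x)); split; last first.
  by apply: eU => //=; rewrite sub0r normrN gtr0_norm.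
have n0 := ocone_neq0 i0 oc.
split; last exact: normalize_sphere.
by apply/oconeZ => //; exact: normalize_coef.
Qed.

Lemma sphere_interior_ccone (I : finType) (v : I -> E) : (forall j, v j != 0) ->
  sphere_interior (ccone v `&` sphere R d) = ocone v `&` sphere R d.
Proof.
move=> v0; apply/seteqP; split => [x [[vx Sx] nx]|x [vx Sx]]; last first.
  split; first by split => //; exact: ocone_ccone.
  by apply: filterS (ocone_near vx) => y vy Sy; split => //; exact: ocone_ccone.
split => // j; rewrite lt_neqAle eq_sym vx andbT; apply/eqP => vjx.
have : (fun s : R => normalize (x + s *: (- v j))) @ (0 : R)^'+ --> x.
  exact: normalize_line_cvg.
move=> /(_ _ nx) [e /= e0 eU].
have [e20 e2e] : 0 < e / 2 /\ e / 2 < e by move: e0 => /= e0; split; lra.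
(* Moving along [- v j] from a point where [dot (v j)] vanishes leaves the cone at once. The moved
   point is nonzero because its product with [x] is still 1. *)
pose y := x + (e / 2) *: (- v j).
have y0 : y != 0.
  apply/eqP => y0; have : dot y x = 0 by rewrite y0 dot0l.
  rewrite dotDl dotZl dotNl vjx oppr0 mulr0 addr0 Sx => /eqP.
  by rewrite oner_eq0.
have [|vy _] := eU (e / 2) _ e20 (normalize_sphere y0).
  by rewrite /= sub0r normrN gtr0_norm.
have /cconeZ - /(_ (normalize_coef y0)) /(_ j) := vy.
rewrite dotDr dotZr dotNr vjx add0r mulrN oppr_ge0 pmulr_rle0// leNgt.
by rewrite dot_gt0 v0.
Qed.

End Cones.

(** * Cells of tessellations and of their sections as sign vectors *)

Section Tessellation.
Context {R : realType} {d : nat}.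
Local Notation E := 'rV[R]_d.+1.
Implicit Types (x y z u : E) (L : set E).

(* Each sign of [dot (w j)] is constant on a connected set avoiding the
   hyperspheres, since its image is an interval avoiding 0; conversely
   [ocone v `&` sphere] is star-shaped along normalized segments. *)
Lemma component_ocone (I : finType) (i0 : I) (w : I -> E) (S : I -> set E) x :
  (forall j, S j = [set y | dot (w j) y = 0] `&` sphere R d) ->
  let U := sphere R d `\` \bigcup_i S i in
  U x -> connected_component U x =
    ocone (flip w [ffun j => dot (w j) x < 0]) `&` sphere R d.
Proof.
move=> SE U [Sx Ux]; set v := flip _ _.
have wU y : U y -> forall j, dot (w j) y != 0.
  by move=> [Sy Uy] j; apply/eqP => wy; apply: Uy; exists j => //; rewrite SE.
have vx : ocone v x by apply: flip_ocone; exact: wU.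
have vU : ocone v `&` sphere R d `<=` U.
  move=> y [vy Sy]; split => // -[j _]; rewrite SE => -[/= wy _].
  by have := vy j; rewrite dot_flip wy mulr0 ltxx.
apply/seteqP; split => [y [C [Cx CU cC] Cy]|y [vy Sy]].
  split; last exact: (CU _ Cy).1.
  move=> j; rewrite ltNge; apply/negP => vjy.
  have /connected_intervalP iv : connected (dot (v j) @` C).
    apply: connected_continuous_connected => //.
    exact/continuous_subspaceT/dot_continuous.
  have iC z : C z -> (dot (v j) @` C) (dot (v j) z) by exists z.
  have [|z Cz] := iv _ _ (iC _ Cy) (iC _ Cx) 0; first by rewrite vjy ltW.
  rewrite dot_flip => /eqP; rewrite mulf_eq0 signr_eq0/=.
  by apply/negP/wU/CU.
pose z (t : R) : E := x + t *: (y - x).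
have vz t : 0 <= t <= 1 -> ocone v (z t).
  move=> /andP[t0 t1].
  have -> : z t = (1 - t) *: x + t *: y by rewrite /z scalerBr scalerBl scale1r addrA addrAC.
  have [->|tn0] := eqVneq t 0; first by rewrite subr0 scale1r scale0r addr0.
  rewrite addrC; apply: ocone_add; first by apply/oconeZ => //; rewrite lt_neqAle eq_sym tn0.
  by move=> j; rewrite dotZr mulr_ge0// ?subr_ge0// ltW// vx.
exists ((fun t => normalize (z t)) @` `[0, 1]).
  split.
  - exists 0; first by rewrite /= in_itv/= lexx ler01.
    by rewrite /z scale0r addr0 normalize_id.
  - move=> _ [t /= t01 <-]; rewrite in_itv/= in t01; apply: vU.
    have z0 := ocone_neq0 i0 (vz _ t01).
    split; last exact: normalize_sphere.
    by apply/oconeZ; [exact: normalize_coef|exact: vz].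
  - apply: connected_continuous_connected; first exact: segment_connected.
    apply: continuous_in_subspaceT => t; rewrite inE/= in_itv/= => t01.
    apply: normalize_cvg; first exact: ocone_neq0 i0 (vz _ t01).
    apply: (@cvgD _ E); first exact: cvg_cst.
    by apply: (@cvgZr_tmp _ E); exact: cvg_id.
exists 1; first by rewrite /= in_itv/= lexx ler01.
by rewrite /z scale1r addrC subrK normalize_id.
Qed.

Definition cell (I : Type) (w : I -> E) L (e : I -> bool) : set E := L `&` ccone (flip w e).

(** Only sign vectors realized strictly on [L] are kept; they correspond bijectively to the cells,
    see [cell_inj]. The set [L] may be a flat of the sphere or a linear subspace. *)
Definition active (I : finType) (w : I -> E) L : {set {ffun I -> bool}} :=
  [set e : {ffun I -> bool} | `[< L `&` ocone (flip w e) !=set0 >]].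

Lemma activeP (I : finType) (w : I -> E) L (e : {ffun I -> bool}) :
  reflect (exists2 x, L x & ocone (flip w e) x) (e \in active w L).
Proof.
by rewrite inE; apply: (iffP (asboolP _)) => [[x []]|[x]]; exists x.
Qed.

Lemma cell_inj (I : finType) (w : I -> E) L :
  {in active w L &, injective (fun e : {ffun I -> bool} => cell w L e)}.
Proof.
move=> e e' /activeP[x Lx ex] _ ee'.
have [_ ] : cell w L e' x by rewrite -ee'; split => //; exact: ocone_ccone.
exact: flip_inj ex.
Qed.

Lemma tessellationE m (w : 'I_m.+1 -> E) (S : 'I_m.+1 -> set E) :
  (forall j, S j = [set y | dot (w j) y = 0] `&` sphere R d) ->
  tessellation S = [set cell w (sphere R d) e | e in [set` active w (sphere R d)]].
Proof.
move=> SE; apply/seteqP; split => [_ [x Ux <-]|_ [e /= /activeP[x Sx ex] <-]].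
  rewrite (component_ocone ord0 SE Ux).
  have wx j : dot (w j) x != 0.
    by apply/eqP => wx; apply: Ux.2; exists j => //; rewrite SE; split => //; exact: Ux.1.
  exists [ffun j => dot (w j) x < 0].
    by apply/activeP; exists x; [exact: Ux.1|exact: flip_ocone].
  by rewrite /cell setIC; apply/esym/(closure_ocone ord0 (flip_ocone wx)).
have wx j : dot (w j) x != 0.
  by apply: contraTneq (ex j) => wx; rewrite dot_flip wx mulr0 ltxx.
have Ux : (sphere R d `\` \bigcup_i S i) x.
  by split => // -[j _]; rewrite SE => -[/= /eqP]; rewrite (negbTE (wx j)).
exists x => //; rewrite (component_ocone ord0 SE Ux).
have -> : [ffun j => dot (w j) x < 0] = e.
  apply: flip_inj (ocone_ccone ex); exact: flip_ocone.
by rewrite (closure_ocone ord0 ex) /cell setIC.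
Qed.

(** The interior of a cell relative to the sphere is its open cone, so a cell contributes exactly
    when its signs are strictly realized on [L]. Without hyperspheres both sides reduce to [L]
    alone. *)
Lemma section_tessE m (w : 'I_m -> E) (S : 'I_m -> set E) L :
  L `<=` sphere R d -> L !=set0 -> (forall j, w j != 0) ->
  (forall j, S j = [set y | dot (w j) y = 0] `&` sphere R d) ->
  section_tess (tessellation S) L = [set cell w L e | e in [set` active w L]].
Proof.
move=> LS [x0 Lx0] w0 SE; case: m w S w0 SE => [|m] w S w0 SE.
  have triv (e : {ffun 'I_0 -> bool}) x : ccone (flip w e) x by case.
  have sint : sphere_interior (sphere R d) = sphere R d.
    by apply/seteqP; split => [x []//|x Sx]; split => //; exact: filterE.
  apply/seteqP; split => [_ [_ [-> _] <-]|_ [e _ <-]].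
    exists [ffun=> true]; first by apply/activeP; exists x0 => // -[].
    by rewrite /cell setIC; apply/seteqP; split => x [? ?]; split => //; exact: LS.
  exists (sphere R d); first by split => //; exists x0; split => //; rewrite sint; exact: LS.
  by rewrite /cell setIC; apply/seteqP; split => x [? ?]; split => //; exact: LS.
have cellI e : cell w (sphere R d) e `&` L = cell w L e.
  rewrite /cell; apply/seteqP; split => x; first by move=> [[? ?] ?].
  by move=> [? ?]; do 2?split => //; exact: LS.
have sint e : sphere_interior (cell w (sphere R d) e) =
    ocone (flip w e) `&` sphere R d.
  by rewrite /cell setIC sphere_interior_ccone// => j; exact: flip_neq0.
rewrite (tessellationE SE); apply/seteqP; split.
  move=> _ [_ [[e /= ae <-] [x [+ Lx]]] <-]; rewrite sint => -[ex Sx].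
  by exists e; [apply/activeP; exists x|rewrite cellI].
move=> _ [e /= /activeP[x Lx ex] <-].
exists (cell w (sphere R d) e); last exact: cellI.
split; first by exists e => //; apply/activeP; exists x => //; exact: LS.
by exists x; split => //; rewrite sint; split => //; exact: LS.
Qed.

End Tessellation.

Lemma card_fset_set_image (T : finType) (U : choiceType) (f : T -> U) (A : {set T}) :
  {in A &, injective f} -> #|` fset_set [set f x | x in [set` A]]| = #|A|.
Proof.
move=> fI; have -> : fset_set [set f x | x in [set` A]] = [fset y in map f (enum A)]%fset.
  apply/fsetP => y; rewrite in_fset_set; last exact/finite_image/finite_finset.
  rewrite !inE/=; apply/asboolP/mapP => [[x Ax <-]|[x]]; first by exists x => //; rewrite mem_enum.
  by rewrite mem_enum => Ax ->; exists x.
rewrite card_fseq undup_id ?size_map -?cardE//.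
by rewrite map_inj_in_uniq ?enum_uniq// => x y; rewrite !mem_enum; exact: fI.
Qed.

(** * Measurability of cells and of cell frequencies *)

Section CellMeasurability.
Context {R : realType} {d : nat}.
Local Notation E := 'rV[R]_d.+1.

(** The sum of the [g j + |g j|], twice the positive parts, turns a finite system of inequalities
    into a single one. *)
Lemma measurable_proj_fin (dY : measure_display) (Y : measurableType dY)
    (J : finType) (Q : set E) (g : J -> Y -> E -> R) :
  compact Q -> (forall j y, continuous (g j y)) ->
  (forall j z, measurable_fun setT (g j ^~ z)) ->
  measurable [set y | exists2 z, Q z & forall j, g j y z <= 0].
Proof.
move=> cQ cg mg; pose h y z := \sum_j (g j y z + `|g j y z|).
have hP y z : h y z <= 0 <-> forall j, g j y z <= 0.
  have pos j : 0 <= g j y z + `|g j y z| by have := ler_norm (- g j y z); rewrite normrN; lra.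
  split => [h0 j|g0].
    have : h y z == 0 by rewrite eq_le h0 sumr_ge0.
    rewrite psumr_eq0// => /allP/(_ j (mem_index_enum _))/= /eqP.
    by have := normr_ge0 (g j y z); lra.
  by rewrite /h big1// => j _; rewrite ler0_norm// subrr.
rewrite (_ : [set y | _] = [set y | exists2 z, Q z & h y z <= 0]); last first.
  by apply/seteqP; split => y [z Qz] /hP H; exists z.
apply: measurable_proj => // [y|z].
  apply: (@continuous_big _ _ +%R 0 _ (@add_continuous _)) => j _ z.
  by apply: (@cvgD _ _ _ (nbhs z)); [|apply: (@cvg_norm _ _ _ (nbhs z))]; exact: cg.
apply: measurable_sum => j; apply: measurable_funD => //.
exact: (measurableT_comp (@normr_measurable _ _)).
Qed.

(** Sets outside [K_s(d)] get the whole sphere as default, so that set-valued maps become total maps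
    into [K_s(d)]. *)
Definition to_sconvex (A : set E) : sconvex R d :=
  if pselect (spherically_convex A) is left p then SConvex p
  else SConvex (@sphere_spherically_convex R d).

Lemma to_sconvexE (A : set E) : spherically_convex A -> to_sconvex A = A :> set E.
Proof. by rewrite /to_sconvex; case: pselect. Qed.

Lemma to_sconvexK (K : sconvex R d) : to_sconvex K = K.
Proof. by apply: sconvex_inj; rewrite to_sconvexE//; exact: sconvexP. Qed.

(** Where [F] is empty the default sphere appears. This event is itself measurable, being the
    complement of the event that [F] hits the whole space. *)
Lemma measurable_to_sconvex (dY : measure_display) (Y : measurableType dY) (F : Y -> set E) :
  (forall C, closed C -> measurable [set y | F y `&` C !=set0]) ->
  (forall y, F y !=set0 -> spherically_convex (F y)) ->
  measurable_fun setT (fun y => to_sconvex (F y)).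
Proof.
move=> mF cF; apply: measurable_fun_hit => C cC; rewrite setTI.
pose N := [set y | F y `&` setT !=set0].
have mN : measurable N by apply: mF; exact: closedT.
rewrite (_ : _ @^-1` _ = [set y | F y `&` C !=set0] `|`
    (~` N `&` [set y | sphere R d `&` C !=set0])).
  apply: measurableU; first exact: mF.
  apply: measurableI; first exact: measurableC.
  have [H|H] := pselect (sphere R d `&` C !=set0).
    by rewrite (_ : [set _ | _] = setT)//; apply/seteqP; split.
  by rewrite (_ : [set _ | _] = set0)//; apply/seteqP; split.
have NE y : N y -> to_sconvex (F y) = F y :> set E.
  by move=> [x [Fx _]]; rewrite to_sconvexE//; apply: cF; exists x.
have NNE y : ~ N y -> to_sconvex (F y) = sphere R d :> set E.
  move=> Ny; rewrite /to_sconvex; case: pselect => //= p.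
  by exfalso; apply: Ny; have [x Kx] := sconvex_nonempty (SConvex p); exists x.
apply/seteqP; split => y; rewrite /= /hit/=.
  have [Ny|Ny] := pselect (N y); first by rewrite NE//; left.
  by rewrite NNE//; right.
case=> [cy|[Ny cy]]; last by rewrite NNE.
by rewrite NE//; have [x [cx Cx]] := cy; exists x.
Qed.

Lemma cell_spherically_convex (I : Type) (w : I -> E) (L : sconvex R d) e :
  cell w L e !=set0 -> spherically_convex (cell w L e).
Proof.
move=> [x [Lx ex]]; have [C [[C0 Cc CZ] cC _ LE]] := sconvexP L.
exists (C `&` ccone (flip w e)); split.
- split.
  + by split => // j; rewrite dot0r.
  + move=> y z t; rewrite !inE => -[Cy ey] [Cz ez]; split.
      by have := Cc y z t; rewrite !inE; apply.
    by move=> j; rewrite /conv/= dotDr !dotZr addr_ge0// mulr_ge0// subr_ge0.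
  + move=> t y t0 [Cy ey]; split; first exact: CZ.
    by move=> j; rewrite dotZr mulr_ge0.
- exact: closedI cC (@ccone_closed _ _ _ _).
- move=> C1; move: Lx; rewrite LE => -[Cx Sx].
  have : (C `&` ccone (flip w e)) x by [].
  by rewrite C1 => /= x0; have := sphere_neq0 Sx; rewrite x0 eqxx.
- by rewrite /cell LE; apply/seteqP; split => y; [case=> -[]|case=> -[]].
Qed.

(* [A] is applied to the cells through [to_sconvex], which is the identity on
   nonempty cells. *)
Definition cell_freq (I : finType) (w : I -> E) (L : sconvex R d) (A : set (sconvex R d)) : R :=
  #|[set e in active w L | `[< A (to_sconvex (cell w L e)) >]]|%:R / #|active w L|%:R.

Lemma cell_freq_ge0 (I : finType) (w : I -> E) L A : 0 <= cell_freq w L A.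
Proof. by rewrite divr_ge0. Qed.

Lemma active_cell_convex (I : finType) (w : I -> E) (L : sconvex R d) (e : {ffun I -> bool}) :
  e \in active w L -> spherically_convex (cell w L e).
Proof.
move=> /activeP[x Lx ex]; apply: cell_spherically_convex.
by exists x; split => //; exact: ocone_ccone.
Qed.

Lemma card_cells (I : finType) (w : I -> E) (L : sconvex R d) (A : set (sconvex R d)) :
  #|` fset_set ([set cell w L e | e in [set` active w L]] `&` [set (K : set E) | K in A])|
  = #|[set e in active w L | `[< A (to_sconvex (cell w L e)) >]]|.
Proof.
rewrite -(@card_fset_set_image _ _ (fun e : {ffun I -> bool} => cell w L e)); last first.
  move=> e e'; rewrite !inE => /andP[ae _] /andP[ae' _].
  by apply: (@cell_inj _ _ _ w L); rewrite inE.
congr (#|` fset_set _|); apply/seteqP; split => [_ [[e /= ae <-] [K AK KE]]|_ [e /= ae <-]].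
  exists e => //=; rewrite inE ae/=; apply/asboolP.
  by rewrite -KE to_sconvexK.
move: ae; rewrite inE => /andP[ae /asboolP Ae]; split; first by exists e.
by exists (to_sconvex (cell w L e)) => //; rewrite to_sconvexE//; exact: active_cell_convex.
Qed.

Lemma uniform_mass_section m (w : 'I_m -> E) (S : 'I_m -> set E) (L : sconvex R d) A :
  (forall j, w j != 0) -> (forall j, S j = [set y | dot (w j) y = 0] `&` sphere R d) ->
  uniform_mass (section_tess (tessellation S) L) A = cell_freq w L A.
Proof.
move=> w0 SE; rewrite (section_tessE _ _ w0 SE); last exact: sconvex_nonempty.
  rewrite /uniform_mass card_cells card_fset_set_image//; exact: cell_inj.
exact: sconvex_sphere.
Qed.

(** A set-valued map into a finite type has finitely many values, each taken on a finite Boolean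
    combination of membership events. It serves for cardinalities. *)
Lemma measurable_set_valued (dY : measure_display) (Y : measurableType dY) (T : finType)
    (D : Y -> {set T}) (f : {set T} -> R) :
  (forall e, measurable [set y | e \in D y]) -> measurable_fun setT (fun y => f (D y)).
Proof.
move=> mD.
have mDa a : measurable [set y | D y = a].
  rewrite (_ : [set y | _] = \bigcap_(e in setT)
      (if e \in a then [set y | e \in D y] else ~` [set y | e \in D y])).
    apply: fin_bigcap_measurable => [|e _]; first exact: finite_finset.
    by case: ifP => _; [|apply: measurableC].
  apply/seteqP; split => [y /= Da e _|y /= H].
    by rewrite -Da; case: ifPn => //= /negP.
  by apply/setP => e; have := H e I; case: ifP => _ // /negP/negbTE.
have -> : (fun y => f (D y)) = (fun y => \sum_a \1_[set y | D y = a] y * f a).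
  apply/funext => y; rewrite (bigD1 (D y))//= big1 ?addr0.
    by rewrite indicE mem_set// mul1r.
  by move=> a aD; rewrite indicE memNset ?mul0r//= => /eqP; rewrite eq_sym (negbTE aD).
apply: measurable_sum => a; apply: measurable_funM; last exact: measurable_cst.
exact: measurable_indic.
Qed.

Section Param.
Context {dY : measure_display} {Y : measurableType dY} {I : finType}.
Variables (L : Y -> sconvex R d) (w : I -> Y -> E).
Hypotheses (mL : measurable_fun setT L)
           (mw : forall j x, measurable_fun setT (fun y => dot (w j y) x)).

Let mdist x : measurable_fun setT (fun y => dist_to (L y) x).
Proof. exact: (measurableT_comp (measurable_dist_to x)). Qed.

Let mflip (e : I -> bool) j x : measurable_fun setT (fun y => dot (flip (w ^~ y) e j) x).
Proof.
under eq_fun do rewrite dot_flip.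
by apply: measurable_funM; [exact: measurable_cst|exact: mw].
Qed.

(** Strict positivity is not closed; it is the union over [p] of the closed conditions
    [1/(p+1) <= dot]. *)
Lemma measurable_active (e : {ffun I -> bool}) :
  measurable [set y | e \in active (w ^~ y) (L y)].
Proof.
(* The index [None] carries the condition that [x] lies in [L y]. *)
pose g (p : nat) (j : option I) y x : R := if j is Some j
  then p.+1%:R^-1 - dot (flip (w ^~ y) e j) x else dist_to (L y) x.
rewrite (_ : [set y | _] = \bigcup_(p in setT)
    [set y | exists2 x, sphere R d x & forall j, g p j y x <= 0]).
  apply: bigcupT_measurable => p; apply: measurable_proj_fin.
  - exact: sphere_compact.
  - move=> [j|] y /=; last exact: dist_to_continuous.
    move=> x; apply: (@cvgB _ _ _ (nbhs x)); first exact: cvg_cst.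
    exact: dot_continuous.
  - move=> [j|] x /=; last exact: mdist.
    by apply: measurable_funB; [exact: measurable_cst|exact: mflip].
apply/seteqP; split => [y /= /activeP[x Lx ex]|y [p _ [x Sx gx]]].
  (* Slope [-1] for every constraint yields one slack that is valid for all of them. *)
  have [t t0 tP] := @affine_pos R I (fun j => dot (flip (w ^~ y) e j) x) (fun=> -1) ex.
  have [p _ /(_ p (leqnn p))/= pt] := near_infty_natSinv_lt (PosNum t0).
  exists p => //; exists x; first exact: sconvex_sphere Lx.
  move=> [j|] /=; last by rewrite dist_to_le0; apply/asboolP.
  have := tP p.+1%:R^-1; rewrite invr_ge0 ler0n (ltW pt) => /(_ isT j).
  by rewrite mulrN1 subr_gt0 subr_le0 => /ltW.
apply/activeP; exists x; first by have := gx None; rewrite /= dist_to_le0 => /asboolP.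
move=> j; have := gx (Some j); rewrite /= subr_le0; apply: lt_le_trans.
by rewrite invr_gt0.
Qed.

Let measurable_cell_hit (e : I -> bool) (C : set E) : closed C ->
  measurable [set y | cell (w ^~ y) (L y) e `&` C !=set0].
Proof.
move=> cC; pose g (j : option I) y x : R := if j is Some j
  then - dot (flip (w ^~ y) e j) x else dist_to (L y) x.
rewrite (_ : [set y | _] = [set y | exists2 x, (sphere R d `&` C) x & forall j, g j y x <= 0]).
  apply: measurable_proj_fin.
  - exact: compact_closedI sphere_compact cC.
  - move=> [j|] y /=; last exact: dist_to_continuous.
    move=> x; apply: (@cvgN _ _ _ (nbhs x)); exact: dot_continuous.
  - move=> [j|] x /=; last exact: mdist.
    exact: (measurableT_comp _ (mflip e j x)).
apply/seteqP; split => [y [x [[Lx ex] Cx]]|y [x [Sx Cx] gx]].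
  exists x; first by split => //; exact: sconvex_sphere Lx.
  move=> [j|] /=; last by rewrite dist_to_le0; apply/asboolP.
  by rewrite oppr_le0; exact: ex.
exists x; split => //; split.
  by have := gx None; rewrite /= dist_to_le0 => /asboolP.
by move=> j; have := gx (Some j); rewrite /= oppr_le0.
Qed.

Lemma measurable_cell (e : I -> bool) :
  measurable_fun setT (fun y => to_sconvex (cell (w ^~ y) (L y) e)).
Proof.
apply: measurable_to_sconvex => [C|y]; first exact: measurable_cell_hit.
exact: cell_spherically_convex.
Qed.

Lemma measurable_cell_freq (A : set (sconvex R d)) : measurable A ->
  measurable_fun setT (fun y => cell_freq (w ^~ y) (L y) A).
Proof.
move=> mA.
apply: measurable_funM; last first.
  apply: (@measurable_set_valued _ _ _ (fun y => active (w ^~ y) (L y)) (fun D => #|D|%:R^-1)).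
  exact: measurable_active.
apply: (@measurable_set_valued _ _ _ (fun y => [set e in active (w ^~ y) (L y) |
  `[< A (to_sconvex (cell (w ^~ y) (L y) e)) >]]) (fun D => #|D|%:R)) => e.
rewrite (_ : [set y | _] = [set y | e \in active (w ^~ y) (L y)] `&`
    (fun y => to_sconvex (cell (w ^~ y) (L y) e)) @^-1` A).
  apply: measurableI; first exact: measurable_active.
  by rewrite -[X in measurable X]setTI; exact: measurable_cell.
apply/seteqP; split => y /=; first by rewrite inE => /andP[? /asboolP].
by move=> [ae Ae]; rewrite inE ae/=; exact/asboolP.
Qed.

End Param.
End CellMeasurability.

(** * General position and the number of cells *)

Section GeneralPosition.
Context {R : realType} {d : nat}.
Local Notation E := 'rV[R]_d.+1.
Implicit Types (x y z u : E) (V W : {vspace E}).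

(** With target [R^o] this is a linear map between vector spaces, so its kernel is a [{vspace E}]
    with a dimension. *)
Definition dot_form u : E -> R^o := dot u.

Lemma dot_form_linear u : linear (dot_form u).
Proof. by move=> a x y; rewrite /dot_form dotDr dotZr. Qed.

HB.instance Definition _ u := GRing.isLinear.Build R E R^o _ (dot_form u) (dot_form_linear u).

Definition hyper u : {vspace E} := lker (linfun (dot_form u)).

Lemma mem_hyper u x : (x \in hyper u) = (dot u x == 0).
Proof. by rewrite memv_ker lfunE. Qed.

Lemma dim_hyper_cap V u x : x \in V -> dot u x != 0 -> (\dim (V :&: hyper u)).+1 = \dim V.
Proof.
move=> Vx ux; rewrite -(limg_ker_dim (linfun (dot_form u)) V) -addn1; congr addn.
apply/esym/eqP; rewrite eqn_leq; apply/andP; split.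
  by rewrite -[leqRHS](dimvf R^o) dimvS// subvf.
rewrite lt0n dimv_eq0; apply: contraNneq ux => f0.
have : linfun (dot_form u) x \in (linfun (dot_form u) @: V)%VS by exact: memv_img.
by rewrite f0 memv0 lfunE.
Qed.

Definition orth (I : finType) (w : I -> E) (J : {set I}) : {vspace E} :=
  (\bigcap_(j in J) hyper (w j))%VS.

Lemma mem_orth (I : finType) (w : I -> E) (J : {set I}) x :
  reflect (forall j, j \in J -> dot (w j) x = 0) (x \in orth w J).
Proof.
rewrite /orth memvE; apply: (iffP subv_bigcapP) => H j jJ.
  by apply/eqP; rewrite -mem_hyper memvE; exact: H.
by rewrite -memvE mem_hyper H.
Qed.

(** Each further hyperplane cuts the current intersection properly, unless that intersection is
    already 0. Relative to [V] the condition is inherited by sections, as the induction on cells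
    requires. *)
Definition general_position (I : finType) (V : {vspace E}) (w : I -> E) : Prop :=
  forall (J : {set I}) j, j \notin J -> (V :&: orth w J)%VS != 0%VS ->
    exists2 x, x \in (V :&: orth w J)%VS & dot (w j) x != 0.

(** Each hyperplane lowers the dimension by one until 0 is reached, which is what the truncated
    subtraction expresses. *)
Lemma dim_orth (I : finType) (w : I -> E) (J : {set I}) :
  general_position fullv w -> \dim (orth w J) = (d.+1 - #|J|)%N.
Proof.
move=> gp; elim: {J}#|J| {1 3}J (erefl #|J|) => [|c IH] J cJ.
  move/eqP: cJ; rewrite cards_eq0 => /eqP ->.
  by rewrite /orth big_set0 dimvf subn0 /dim/= mul1n.
have [j jJ] : exists j, j \in J by apply/set0Pn; rewrite -card_gt0 cJ.
have cJ' : #|J :\ j| = c by have := cardsD1 j J; rewrite jJ cJ => -[].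
have oE : orth w J = (orth w (J :\ j) :&: hyper (w j))%VS.
  by rewrite /orth (big_setD1 j jJ)/= capvC.
have := IH _ cJ'; have [z0|z0] := eqVneq (orth w (J :\ j)) 0%VS.
  rewrite z0 dimv0 oE z0 cap0v dimv0 subnS => <-//.
have jN : j \notin J :\ j by rewrite setD11.
have [|x] := gp _ _ jN; first by rewrite capfv.
rewrite capfv => xo wx; rewrite -(dim_hyper_cap xo wx) -oE => H.
by rewrite subnS -H.
Qed.

(** For [m >= 1] this is twice the sum of the binomials [C(m-1, i)] over [i < v], the classical
    count for central arrangements in dimension [v]. It is 0 for [v = 0] and [m >= 1], as the origin
    satisfies no strict sign condition. *)
Fixpoint ncells (v m : nat) : nat :=
  if m is m'.+1 then if v is v'.+1 then (ncells v m' + ncells v' m')%N else 0 else 1.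

Definition cons_sign m (p : bool * {ffun 'I_m -> bool}) : {ffun 'I_m.+1 -> bool} :=
  [ffun i => if unlift ord0 i is Some j then p.2 j else p.1].

Lemma cons_sign_bij m : bijective (@cons_sign m).
Proof.
exists (fun e : {ffun 'I_m.+1 -> bool} => (e ord0, [ffun j => e (lift ord0 j)])).
  by move=> [b e]; rewrite /cons_sign/=; congr pair; [rewrite ffunE unlift_none|
    apply/ffunP => j; rewrite !ffunE liftK].
move=> e; apply/ffunP => i; rewrite ffunE/=.
by case: unliftP => [j ->|->]//; rewrite ffunE.
Qed.

Lemma ocone_cons m (w : 'I_m.+1 -> E) b (e : {ffun 'I_m -> bool}) x :
  ocone (flip w (cons_sign (b, e))) x <->
  0 < (-1) ^+ b * dot (w ord0) x /\ ocone (flip (w \o lift ord0) e) x.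
Proof.
split => [H|[H0 H] i].
  split; first by have := H ord0; rewrite dot_flip ffunE unlift_none.
  by move=> j; have := H (lift ord0 j); rewrite !dot_flip ffunE liftK.
rewrite dot_flip ffunE; case: unliftP => [j ->|->]//.
by have := H j; rewrite dot_flip.
Qed.

(* Deletion-restriction: a cell of the arrangement without the hyperplane of
   [w ord0] is cut in two iff it meets that hyperplane. *)
Lemma card_active m (w : 'I_m -> E) V : general_position V w ->
  #|active w [set x | x \in V]| = ncells (\dim V) m.
Proof.
elim: m w V => [|m IH] w V gp.
  rewrite /= (_ : active _ _ = [set: _]%SET); first by rewrite cardsT card_ffun card_bool card_ord.
  by apply/setP => e; rewrite [RHS]inE; apply/activeP; exists 0; [exact: mem0v|case].
set u := w ord0; set w' := w \o lift ord0.
have [V0|V0] := eqVneq V 0%VS.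
  rewrite V0 dimv0/=; apply/eqP; rewrite cards_eq0; apply/eqP/setP => e.
  rewrite [RHS]inE; apply/activeP => -[x /=]; rewrite memv0 => /eqP -> /(_ ord0).
  by rewrite dot0r ltxx.
have [y Vy uy] : exists2 y, y \in V & dot u y != 0.
  have [||y] := gp finset.set0 ord0; rewrite ?inE//.
    by rewrite /orth big_set0 capvf.
  by rewrite /orth big_set0 capvf; exists y.
have lift_orth (J : {set 'I_m}) : orth w' J = orth w (lift ord0 @: J).
  by rewrite /orth big_imset//= => i j _ _; exact: lift_inj.
have gp1 : general_position V w'.
  move=> J j jJ; rewrite lift_orth => /gp; apply.
  by rewrite mem_imset//; exact: lift_inj.
have gp2 : general_position (V :&: hyper u)%VS w'.
  have oE J : ((V :&: hyper u) :&: orth w' J = V :&: orth w (ord0 |: (lift ord0 @: J)))%VS.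
    rewrite -capvA lift_orth /orth big_setU1//=.
    by apply/imsetP => -[i _ /eqP]; rewrite (negbTE (neq_lift _ _)).
  move=> J j jJ; rewrite oE => /gp; apply.
  by rewrite !inE eq_sym (negbTE (neq_lift _ _))/= mem_imset//; exact: lift_inj.
have dV := dim_hyper_cap Vy uy.
rewrite -dV /= dV -(IH _ _ gp1) -(IH _ _ gp2).
rewrite -!sum1_card !(big_mkcond (fun e => e \in _))/= -big_split/=.
rewrite (reindex (@cons_sign m))/=; last exact/onW_bij/cons_sign_bij.
pose f b (e : {ffun 'I_m -> bool}) : nat :=
  if cons_sign (b, e) \in active w [set x | x \in V] then 1 else 0.
rewrite (eq_bigr (fun p => f p.1 p.2)); last by case.
rewrite -(pair_bigA _ f)/=.
rewrite exchange_big/=; apply: eq_bigr => e _; rewrite big_bool/= /f.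
have pert x t : x \in V -> x + t *: y \in V by move=> Vx; rewrite memvD// memvZ.
(* A cell point on the hyperplane can be pushed to either side along [y], so both extensions of the
   sign vector occur. *)
have D_AB (b : bool) x : x \in V -> dot u x = 0 -> ocone (flip w' e) x ->
    cons_sign (b, e) \in active w [set x | x \in V].
  move=> Vx ux ex.
  pose z := ((-1) ^+ b * dot u y) *: y.
  have [t t0 tP] := ocone_perturb z ex.
  apply/activeP; exists (x + t *: z); first by rewrite /= memvD// !memvZ.
  apply/ocone_cons; split; last by apply: tP; rewrite lexx ltW.
  rewrite -/u dotDr ux add0r !dotZr mulrCA pmulr_rgt0//.
  rewrite mulrA mulrA -expr2 sqrr_sign mul1r -expr2.
  by rewrite lt_neqAle sqr_ge0 andbT eq_sym sqrf_eq0.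
have [Dt|Df] := boolP (e \in active w' [set x | x \in (V :&: hyper u)%VS]).
  have /activeP[x /=] := Dt; rewrite memv_cap mem_hyper => /andP[Vx /eqP ux] ex.
  rewrite !(D_AB _ x)//; have -> // : e \in active w' [set x | x \in V].
  by apply/activeP; exists x.
have notD x : x \in V -> ocone (flip w' e) x -> dot u x != 0.
  move=> Vx ex; apply: contraNneq Df => ux; apply/activeP; exists x => //=.
  by rewrite memv_cap Vx mem_hyper ux eqxx.
have AC b : cons_sign (b, e) \in active w [set x | x \in V] -> e \in active w' [set x | x \in V].
  by move=> /activeP[x Vx /ocone_cons[_ ex]]; apply/activeP; exists x.
have [/activeP[x /= Vx ex]|Cf] := boolP (e \in active w' [set x | x \in V]); last first.
  by rewrite !(contraNF (AC _) Cf).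
have key (b : bool) : 0 < (-1) ^+ b * dot u x ->
  (cons_sign (b, e) \in active w [set x | x \in V]) /\
  (cons_sign (~~ b, e) \notin active w [set x | x \in V]).
  move=> bx; split; first by apply/activeP; exists x => //; apply/ocone_cons.
  apply/negP => /activeP[z /= Vz /ocone_cons[bz ez]].
  (* If both sides occurred without a common point on the hyperplane, these positive coefficients
     would combine [x] and [z] to one, the cell being convex. *)
  pose a := - ((-1) ^+ b * dot u z).
  have a0 : 0 < a.
    by move: bz; rewrite /a -/u; case: (b); rewrite /= ?expr0 ?expr1 ?mulN1r ?mul1r ?opprK.
  have /eqP[] : dot u (a *: x + ((-1) ^+ b * dot u x) *: z) != 0.
    apply: notD; first by rewrite memvD// memvZ.
    by apply: ocone_add; [exact/oconeZ|exact/ocone_ccone/oconeZ].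
  by rewrite dotDr !dotZr /a; ring.
have := notD x Vx ex.
case: (ltrgt0P (dot u x)) => // ux _.
  have [|] := key false; rewrite ?expr0 ?mul1r//= => -> /negbTE -> //.
have [|] := key true; rewrite ?expr1 ?mulN1r ?oppr_gt0//= => -> /negbTE -> //.
Qed.

End GeneralPosition.

(** * Faces of the tessellation as cells of flats *)

Section Faces.
Context {R : realType} {d : nat}.
Local Notation E := 'rV[R]_d.+1.
Implicit Types (x y z u : E) (V W : {vspace E}).

Lemma tessellation_cells n (w : 'I_n -> E) (S : 'I_n -> set E) :
  (forall j, S j = [set y | dot (w j) y = 0] `&` sphere R d) ->
  tessellation S = [set cell w (sphere R d) e | e in [set` active w (sphere R d)]].
Proof.
case: n w S => [|n] w S SE; last exact: tessellationE.
have cE (e : {ffun 'I_0 -> bool}) : cell w (sphere R d) e = sphere R d.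
  by apply/seteqP; split => [x []//|x Sx]; split => // -[].
apply/seteqP; split => [_ ->|_ [e _ <-]]; last by rewrite cE.
exists [ffun=> true]; last exact: cE.
by apply/activeP; exists (delta_mx 0 0); [exact: sphere_nonempty|case].
Qed.

Lemma polyhedral_cone_cone C x (t : R) : polyhedral_cone C -> 0 < t ->
  C (t *: x) <-> C x.
Proof.
move=> [m [a ->]] t0; split => /= H i; have := H i.
  by rewrite dotZr pmulr_rle0.
by rewrite dotZr pmulr_rle0.
Qed.

Lemma ccone_polyhedral n (v : 'I_n -> E) : polyhedral_cone (ccone v).
Proof.
exists n, (fun i => - v i); apply/seteqP; split => x /= H i; have := H i.
  by rewrite dotNl oppr_le0.
by rewrite dotNl oppr_le0.
Qed.

(** A cone is determined by its unit vectors. Since [polytope_faces] asserts only the existence of a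
    cone, this identifies it with the one given by the sign vector. *)
Lemma polyhedral_cone_sphere C D : polyhedral_cone C -> polyhedral_cone D ->
  C `&` sphere R d = D `&` sphere R d -> C = D.
Proof.
move=> pC pD CD.
suff sub (A B : set E) : polyhedral_cone A -> polyhedral_cone B ->
    A `&` sphere R d = B `&` sphere R d -> A `<=` B.
  by apply/seteqP; split; apply: sub.
move=> pA pB AB x Ax; have [->|x0] := eqVneq x 0.
  by have [m [b ->]] := pB => i /=; rewrite dot0r.
have [t t0 St] := sphere_scale x0.
apply/(polyhedral_cone_cone x pB t0).
have : (B `&` sphere R d) (t *: x).
  by rewrite -AB; split => //; apply/(polyhedral_cone_cone x pA t0).
by case.
Qed.

(** From the relative interior point [x0] a short step in any direction [y] of [orth v J] stays in
    the face. Hence [W] contains [x0] and [x0 + t *: y], and so [y]. *)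
Lemma span_ccone_face (I : finType) (v : I -> E) (J : {set I}) x0 W :
  x0 \in orth v J -> (forall j, j \notin J -> 0 < dot (v j) x0) ->
  (forall x, x \in orth v J -> ccone v x -> x \in W) -> (orth v J <= W)%VS.
Proof.
move=> /mem_orth x0J x0v GW; apply/subvP => y /mem_orth yJ.
pose a j := if j \in J then 1 else dot (v j) x0.
have [|t t0 tP] := @affine_pos R I a (fun j => dot (v j) y).
  by move=> j; rewrite /a; case: ifPn => // /x0v.
have Wt s : 0 <= s <= t -> x0 + s *: y \in W.
  move=> st; apply: GW.
    by apply/mem_orth => j jJ; rewrite dotDr dotZr x0J// yJ// mulr0 addr0.
  move=> j; rewrite dotDr dotZr; have [jJ|jJ] := boolP (j \in J).
    by rewrite x0J// yJ// mulr0 addr0.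
  by have := tP s st j; rewrite /a (negbTE jJ) => /ltW.
have W0 : x0 \in W by have := Wt 0; rewrite scale0r addr0; apply; rewrite lexx ltW.
have W1 : t *: y \in W.
  rewrite -[_ *: _](addKr x0) addrC memvB//.
  by apply: Wt; rewrite lexx ltW.
by rewrite -[y]scale1r -(mulVf (lt0r_neq0 t0)) -scalerA memvZ.
Qed.

Lemma orth_flip (I : finType) (w : I -> E) (e : I -> bool) (J : {set I}) :
  orth (flip w e) J = orth w J.
Proof.
apply/vspaceP => x; apply/mem_orth/mem_orth => H j jJ.
  by have := H j jJ; rewrite dot_flip => /eqP; rewrite mulf_eq0 signr_eq0 => /eqP.
by rewrite dot_flip H// mulr0.
Qed.

(* Summing, over the constraints [j] that do not vanish on the face, a point of
   the face at which [v j] is positive, one gets a relative interior point. *)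
Lemma cone_face_ccone n (v : 'I_n -> E) G : cone_face (ccone v) G ->
  exists J x0, [/\ x0 \in orth v J, forall j, j \notin J -> 0 < dot (v j) x0 &
    G = ccone v `&` [set x | x \in orth v J]].
Proof.
move=> [a aC GE]; pose J := [set j : 'I_n | `[< forall x, G x -> dot (v j) x = 0 >]]%SET.
have GP x : G x <-> ccone v x /\ dot a x = 0 by rewrite GE.
have /choice[f fP] j : exists x, G x /\ (j \notin J -> 0 < dot (v j) x).
  have G0 : G 0 by apply/GP; split; [move=> i|]; rewrite dot0r.
  have [jJ|] := boolP (j \in J); first by exists 0.
  rewrite inE => /asboolP/existsNP[x /not_implyP[Gx /eqP vx]].
  exists x; split => // _; rewrite lt_neqAle eq_sym vx/=.
  by have /GP[+ _] := Gx; apply.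
have fC i j : 0 <= dot (v i) (f j) by have [/GP[+ _] _] := fP j; apply.
exists J, (\sum_j f j); split.
- apply/mem_orth => i; rewrite inE => /asboolP vi; rewrite dot_sumr big1// => j _.
  by apply: vi; have [] := fP j.
- move=> j jJ; rewrite dot_sumr (bigD1 j)//= ltr_pwDl//.
    by have [_] := fP j; apply.
  by apply: sumr_ge0 => i _.
have x0C : ccone v (\sum_j f j).
  by move=> i; rewrite dot_sumr; apply: sumr_ge0 => j _.
have x0a : dot a (\sum_j f j) = 0.
  by rewrite dot_sumr big1// => j _; have [/GP[]] := fP j.
apply/seteqP; split => x.
  move=> Gx; split; first by have /GP[] := Gx.
  by apply/mem_orth => j; rewrite inE => /asboolP; apply.
move=> [vx /mem_orth xJ]; apply/GP; split => //.
apply/eqP; rewrite eq_le aC//=.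
pose b j := if j \in J then 1 else dot (v j) (\sum_j f j).
have [|t t0 tP] := @affine_pos R _ b (fun j => - dot (v j) x).
  move=> j; rewrite /b; case: ifPn => // jJ; rewrite dot_sumr (bigD1 j)//= ltr_pwDl//.
    by have [_] := fP j; apply.
  by apply: sumr_ge0 => i _.
(* A relative interior point minus a small multiple of [x] is still in the cone, which forces
   [dot a x] to be nonnegative as well. *)
have : dot a (\sum_j f j - t *: x) <= 0.
  apply: aC => j; rewrite dotBr dotZr; have [jJ|jJ] := boolP (j \in J).
    by rewrite xJ// mulr0 subr0 x0C.
  have := tP t; rewrite lexx ltW// => /(_ isT j); rewrite /b (negbTE jJ) mulrN.
  exact: ltW.
by rewrite dotBr x0a dotZr sub0r oppr_le0 pmulr_rge0.
Qed.

Section WithPosition.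
(** For [#|J| = d - k], [beta J] enumerates the complement of [J], so [w \o beta J] is the
    arrangement that subdivides the flat of [J]. *)
Variables (n k m : nat) (w : 'I_n -> E) (beta : {set 'I_n} -> 'I_m -> 'I_n).
Hypotheses (hk : (k <= d)%N) (gp : general_position fullv w).
Hypothesis betaP : forall J : {set 'I_n}, #|J| = (d - k)%N ->
  injective (beta J) /\ forall j, (j \in J) = ~~ [exists i, beta J i == j].

Definition flat (J : {set 'I_n}) : set E := [set x | x \in orth w J] `&` sphere R d.

Let dim_flat (J : {set 'I_n}) : #|J| = (d - k)%N -> \dim (orth w J) = k.+1.
Proof. by move=> cJ; rewrite dim_orth// cJ; lia. Qed.

Let flip_comp (J : {set 'I_n}) (e : 'I_n -> bool) (e' : {ffun 'I_m -> bool}) i :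
  e (beta J i) = e' i -> flip (w \o beta J) e' i = flip w e (beta J i).
Proof. by rewrite /flip => ->. Qed.

Let beta_notin (J : {set 'I_n}) j : #|J| = (d - k)%N -> j \notin J -> exists i, beta J i = j.
Proof.
by move=> cJ; rewrite (betaP cJ).2 negbK => /existsP[i /eqP ij]; exists i.
Qed.

Let beta_in (J : {set 'I_n}) i : #|J| = (d - k)%N -> beta J i \notin J.
Proof. by move=> cJ; rewrite (betaP cJ).2 negbK; apply/existsP; exists i. Qed.

(** General position provides a dual vector for each [i] in [J], vanishing against the other normals
    of [J]; their sum is the solution. It is the direction in which a face is left towards the
    interior of a cell. *)
Lemma orth_pos (J : {set 'I_n}) : (#|J| <= d.+1)%N ->
  exists y, forall i, i \in J -> dot (w i) y = 1.
Proof.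
move=> cJ.
have /choice[f fP] i : exists y, i \in J ->
    y \in orth w (J :\ i) /\ dot (w i) y = 1.
  have [iJ|_] := boolP (i \in J); last by exists 0.
  have iN : i \notin J :\ i by rewrite setD11.
  have [|y] := gp iN.
    rewrite capfv -dimv_eq0 dim_orth// -lt0n subn_gt0.
    by move: cJ; rewrite (cardsD1 i J) iJ.
  rewrite capfv => yo wy; exists ((dot (w i) y)^-1 *: y) => _.
  by rewrite memvZ// dotZr mulVf.
exists (\sum_(i in J) f i) => i iJ; rewrite dot_sumr (bigD1 i)//= big1 ?addr0.
  exact: (fP i iJ).2.
move=> j /andP[jJ ji]; have [/mem_orth + _] := fP j jJ; apply.
by rewrite !inE eq_sym ji.
Qed.

(** A cell of a flat is a face of the full cell obtained by perturbing off the flat. Conversely, a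
    face spans some [orth w J] and has a relative interior point, and its dimension forces
    [#|J| = d - k]. *)
Lemma tess_facesE (S : 'I_n -> set E) :
  (forall j, S j = [set y | dot (w j) y = 0] `&` sphere R d) ->
  tess_faces k (tessellation S) = \bigcup_(J in [set J : {set 'I_n} | #|J| = (d - k)%N])
    [set cell (w \o beta J) (flat J) e | e in [set` active (w \o beta J) (flat J)]].
Proof.
move=> SE; rewrite (tessellation_cells SE); apply/seteqP; split; last first.
  move=> _ [J /= cJ [e0 /= /activeP[x0 [x0J Sx0] ex0] <-]].
  (* The value [false] on [J] fits the point [y] below, where these normals take the value 1. *)
  pose e := [ffun j => if [pick i | beta J i == j] is Some i then e0 i else false].
  have ee0 i : e (beta J i) = e0 i.
    rewrite ffunE; case: pickP => [i' /eqP /(betaP cJ).1 ->//|/(_ i)].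
    by rewrite eqxx.
  pose v := flip w e.
  have vx0 j : j \notin J -> 0 < dot (v j) x0.
    by move=> /(beta_notin cJ)[i <-]; rewrite /v -(flip_comp (ee0 i)).
  have oJ : orth v J = orth w J by exact: orth_flip.
  have [y yP] := @orth_pos J ltac:(rewrite cJ; lia).
  have ePos i : i \in J -> e i = false.
    move=> iJ; rewrite ffunE; case: pickP => // i' /eqP bi.
    by have := beta_in i' cJ; rewrite bi iJ.
  pose b j := if j \in J then 1 else dot (v j) x0.
  have [|t t0 tP] := @affine_pos R _ b (fun j => dot (v j) y).
    by move=> j; rewrite /b; case: ifPn => // /vx0.
  have vx : ocone v (x0 + t *: y).
    move=> j; rewrite dotDr dotZr; have [jJ|jJ] := boolP (j \in J).
      rewrite (mem_orth v J x0 _) ?oJ// add0r mulr_gt0//.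
      by rewrite dot_flip (ePos j jJ) expr0 mul1r yP.
    by have := tP t; rewrite lexx ltW// => /(_ isT j); rewrite /b (negbTE jJ).
  have [z Sz vz] : exists2 z, sphere R d z & ocone v z.
    (* The perturbed point can vanish only if there is no constraint at all, and then [x0] itself
       serves. *)
    have [x0z|xn0] := eqVneq (x0 + t *: y) 0.
      by exists x0 => // j; have := vx j; rewrite x0z dot0r ltxx.
    have [s s0 Ss] := sphere_scale xn0.
    by exists (s *: (x0 + t *: y)) => //; apply/oconeZ.
  exists (cell w (sphere R d) e); first by exists e => //; apply/activeP; exists z.
  exists (ccone v), (ccone v `&` [set x | x \in orth w J]); split.
  - exact: ccone_polyhedral.
  - move=> v0; have := sphere_neq0 Sz.
    have : ccone v z by exact: ocone_ccone.
    by rewrite v0 => ->; rewrite eqxx.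
  - by rewrite /cell setIC.
  - split.
      (* On the cone all products are nonnegative, so this functional vanishes exactly where each
         [dot (v i)] with [i] in [J] does. *)
      exists (- \sum_(i in J) v i) => [x vx'|].
        by rewrite dotNl oppr_le0 dot_suml sumr_ge0.
      apply/seteqP; split => x /= [vx' H]; split => //=.
        rewrite dotNl dot_suml big1 ?oppr0// => i iJ.
        by rewrite dot_flip (mem_orth w J x H) ?mulr0.
      move/eqP: H; rewrite dotNl oppr_eq0 dot_suml psumr_eq0// => /allP H.
      rewrite -oJ; apply/mem_orth => j jJ; apply/eqP.
      by have := H j (mem_index_enum _); rewrite jJ.
    exists (orth w J); split => [||W GW]; first exact: dim_flat.
      by move=> x [].
    rewrite -oJ; apply: span_ccone_face vx0 _; first by rewrite oJ.
    by move=> x xo vx'; apply: GW; split => //=; rewrite -oJ.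
  - apply/seteqP; split => x; last first.
      move=> [[vx' /= xJ] Sx]; split => // i; rewrite (flip_comp (ee0 i)).
      exact: vx'.
    move=> [[xJ Sx] vx']; split => //; split => // j.
    have [jJ|/(beta_notin cJ)[i <-]] := boolP (j \in J).
      by rewrite (mem_orth v J x _) ?oJ.
    by rewrite /v -(flip_comp (ee0 i)); exact: vx'.
move=> F [_ [e /= /activeP[z Sz ez] <-]] [C [G [pC C0 CE [CG [V [dV GV Vmin]]] ->]]].
pose v := flip w e.
have {CE} CE : C = ccone v.
  apply: polyhedral_cone_sphere => //; first exact: ccone_polyhedral.
  by rewrite -CE /cell setIC.
rewrite CE in CG; have [J [x0 [x0J vx0 GE]]] := cone_face_ccone CG.
have oJ : orth v J = orth w J by exact: orth_flip.
have VE : V = orth w J.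
  apply/eqP; rewrite eqEsubv -oJ; apply/andP; split.
    by apply: Vmin; rewrite GE => x [].
  apply: span_ccone_face x0J vx0 _ => x xo vx.
  by apply: GV; rewrite GE.
have cJ : #|J| = (d - k)%N.
  by move: dV; rewrite VE dim_orth// => H; lia.
exists J => //.
pose e' := [ffun i => e (beta J i)].
have ee' i : e (beta J i) = e' i by rewrite ffunE.
exists e'.
  apply/activeP.
  (* The relative interior point is 0 only when [J] contains every index; then any nonzero vector of
     the flat is admissible. *)
  have [x [xJ xn0 vx]] : exists x,
      [/\ x \in orth w J, x != 0 & forall j, j \notin J -> 0 < dot (v j) x].
    have [x00|xn0] := eqVneq x0 0; last by exists x0; split => //; rewrite -oJ.
    have Jall j : j \in J by apply: contraT => /vx0; rewrite x00 dot0r ltxx.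
    have [x [xV xn0]] : exists x, x \in orth w J /\ x != 0.
      exists (vpick (orth w J)); rewrite memv_pick vpick0 -dimv_eq0.
      by rewrite (dim_flat cJ).
    by exists x; split => // j; rewrite Jall.
  have [s s0 Ss] := sphere_scale xn0.
  exists (s *: x); first by split => //=; rewrite memvZ.
  apply/oconeZ => // i; rewrite (flip_comp (ee' i)).
  by apply: vx; exact: beta_in.
apply/seteqP; split => x.
  move=> [[xJ Sx] vx]; rewrite GE oJ; split => //; split => // j.
  have [jJ|/(beta_notin cJ)[i <-]] := boolP (j \in J).
    by rewrite (mem_orth v J x _) ?oJ.
  by rewrite /v -(flip_comp (ee' i)); exact: vx.
rewrite GE oJ => -[[vx /= xJ] Sx]; split => // i; rewrite (flip_comp (ee' i)).
exact: vx.
Qed.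

Let face (p : {set 'I_n} * {ffun 'I_m -> bool}) : set E :=
  cell (w \o beta p.1) (flat p.1) p.2.

Let face_set : {set {set 'I_n} * {ffun 'I_m -> bool}} :=
  [set p : {set 'I_n} * {ffun 'I_m -> bool} |
    (#|p.1| == d - k)%N && (p.2 \in active (w \o beta p.1) (flat p.1))]%SET.

Let face_setE p : (p \in face_set) =
  (#|p.1| == d - k)%N && (p.2 \in active (w \o beta p.1) (flat p.1)).
Proof. by rewrite finset.in_set. Qed.

(** The set [J] is recovered as the indices of the hyperplanes that contain the face, and the signs
    then follow from [cell_inj]. *)
Let face_inj : {in face_set &, injective face}.
Proof.
have key p j : p \in face_set -> (j \in p.1) = `[< forall x, face p x -> dot (w j) x = 0 >].
  case: p => J e; rewrite face_setE/= => /andP[/eqP cJ /activeP[x Lx ex]].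
  apply/idP/asboolP => [jJ y [[/= /mem_orth yJ _] _]|H]; first exact: yJ.
  apply: contraT => /(beta_notin cJ)[i bi].
  have fx : face (J, e) x by split => //; exact: ocone_ccone.
  by have := ex i; rewrite dot_flip/= bi (H x fx) mulr0 ltxx.
move=> p q pF qF pq.
have p1 : p.1 = q.1 by apply/setP => j; rewrite !key// pq.
move: pq pF qF p1; case: p q => [J e] [J' e'] /= pq + + JJ'; rewrite -JJ' in pq *.
rewrite !face_setE/= => /andP[_ ae] /andP[_ ae']; congr pair.
apply: (@cell_inj _ _ _ (w \o beta J) (flat J)) => //.
Qed.

Lemma flat_spherically_convex (J : {set 'I_n}) : #|J| = (d - k)%N -> spherically_convex (flat J).
Proof.
move=> cJ; exists [set x | x \in orth w J]; split => //.
- split => /=; first exact: mem0v.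
    by move=> x y t; rewrite !inE/= => xJ yJ; rewrite memvD// memvZ.
  by move=> t x _ xJ; rewrite memvZ.
- rewrite (_ : [set x | _] = \bigcap_(j in [set` J]) [set x | dot (w j) x = 0]).
    by apply: closed_bigI => j _; exact: closed_dot_eq0.
  apply/seteqP; split => x; first by move=> /mem_orth xJ j /xJ.
  by move=> H; apply/mem_orth => j; exact: H.
- move=> V0; have := dim_flat cJ.
  suff -> : orth w J = 0%VS by rewrite dimv0.
  apply/eqP; rewrite -subv0; apply/subvP => x xJ.
  have : [set x | x \in orth w J] x by [].
  by rewrite V0 => /= ->; exact: mem0v.
Qed.

(** Normalization passes from the linear space to its sphere, and general position descends to
    [orth w J], whose dimension is [k.+1] for every such [J]. *)
Lemma card_active_flat (J : {set 'I_n}) : #|J| = (d - k)%N ->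
  #|active (w \o beta J) (flat J)| = ncells k.+1 m.
Proof.
move=> cJ; rewrite -(dim_flat cJ) -(@card_active _ _ _ (w \o beta J)).
  apply: eq_card => e; apply/activeP/activeP => -[x].
    by move=> [xJ Sx] ex; exists x.
  move=> /= xJ ex.
  have [x0|xn0] := eqVneq x 0; last first.
    have [s s0 Ss] := sphere_scale xn0; exists (s *: x); last exact/oconeZ.
    by split => //=; rewrite memvZ.
  have [y [yJ Sy]] : flat J !=set0.
    by have := sconvex_nonempty (SConvex (flat_spherically_convex cJ)).
  by exists y => // i; have := ex i; rewrite x0 dot0r ltxx.
move=> K i iK; have [bI _] := betaP cJ.
have oE : (orth w J :&: orth (w \o beta J) K = orth w (J :|: (beta J @: K)))%VS.
  apply/vspaceP => x; rewrite memv_cap; apply/andP/mem_orth.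
    move=> [/mem_orth xJ /mem_orth xK] j; rewrite inE => /orP[/xJ//|/imsetP[l lK ->]].
    exact: xK.
  move=> H; split; apply/mem_orth => j jJ; apply: H; rewrite inE; first by rewrite jJ.
  by rewrite imset_f// orbT.
rewrite oE => on0; have := @gp (J :|: (beta J @: K)) (beta J i).
rewrite capfv; apply => //.
rewrite !inE negb_or beta_in//=; apply: contra iK => /imsetP[l lK /bI ->] //.
Qed.

(** Faces are counted as pairs of a set [J] and a sign vector. Equal cell counts for all [J] turn
    the quotient of sums into an average of quotients. *)
Lemma uniform_mass_faces (S : 'I_n -> set E) (A : set (sconvex R d)) :
  (forall j, S j = [set y | dot (w j) y = 0] `&` sphere R d) ->
  uniform_mass (tess_faces k (tessellation S)) A =
  'C(n, d - k)%:R^-1 * \sum_(J : {set 'I_n} | #|J| == (d - k)%N)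
     cell_freq (w \o beta J) (to_sconvex (flat J)) A.
Proof.
move=> SE.
have TE : tess_faces k (tessellation S) = [set face p | p in [set` face_set]].
  rewrite (tess_facesE SE); apply/seteqP; split.
    move=> _ [J /= cJ [e /= ae <-]]; exists (J, e) => //=; rewrite face_setE/= ae andbT.
    exact/eqP.
  move=> _ [[J e] /= + <-]; rewrite face_setE/= => /andP[/eqP cJ ae].
  by exists J => //; exists e.
have flatE (J : {set 'I_n}) : #|J| = (d - k)%N -> to_sconvex (flat J) = flat J :> set E.
  by move=> cJ; rewrite to_sconvexE//; exact: flat_spherically_convex.
have card_pairs (P : pred ({set 'I_n} * {ffun 'I_m -> bool})) :
    #|[set p in face_set | P p]%SET| =
    (\sum_(J : {set 'I_n} | #|J| == (d - k)%N)
      #|[set e in active (w \o beta J) (flat J) | P (J, e)]%SET|)%N.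
  rewrite -sum1_card (eq_bigr (fun J : {set 'I_n} => \sum_(e in [set e in
    active (w \o beta J) (flat J) | P (J, e)]%SET) 1)%N); last by move=> J _; rewrite sum1_card.
  rewrite pair_big_dep/=; apply: eq_bigl => -[J e].
  by rewrite !finset.in_set/= andbA.
have cden : #|face_set| = ('C(n, d - k) * ncells k.+1 m)%N.
  have -> : #|face_set| = #|[set p in face_set | xpredT p]%SET|.
    by apply: eq_card => p; rewrite !inE andbT.
  rewrite card_pairs (eq_bigr (fun=> ncells k.+1 m)); last first.
    move=> J /eqP cJ; rewrite -(card_active_flat cJ); apply: eq_card => e.
    by rewrite inE andbT.
  rewrite sum_nat_const; congr muln.
  rewrite -[n in RHS]card_ord -card_draws; apply: eq_card => J.
  by rewrite !inE unfold_in.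
have cnum : #|` fset_set ([set face p | p in [set` face_set]] `&` [set (K : set E) | K in A])| =
  (\sum_(J : {set 'I_n} | #|J| == (d - k)%N)
    #|[set e in active (w \o beta J) (flat J) |
       `[< A (to_sconvex (cell (w \o beta J) (flat J) e)) >]]%SET|)%N.
  rewrite -(card_pairs (fun p => `[< A (to_sconvex (face p)) >])).
  rewrite -(card_fset_set_image (f := face)); last first.
    by move=> p q /setIdP[pF _] /setIdP[qF _]; exact: face_inj.
  have conv p : p \in face_set -> spherically_convex (face p).
    case: p => J e; rewrite face_setE/= => /andP[/eqP cJ ae].
    have := @active_cell_convex R d _ (w \o beta J) (to_sconvex (flat J)) e.
    by rewrite flatE//; apply.
  congr (#|` fset_set _|); apply/seteqP; split.
    move=> _ [[p /= pF <-] [K AK KE]]; exists p => //=; apply/setIdP.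
    by split => //; apply/asboolP; rewrite -KE to_sconvexK.
  move=> _ [p /= /setIdP[pF /asboolP Ap] <-]; split; first by exists p.
  by exists (to_sconvex (face p)) => //; rewrite to_sconvexE//; exact: conv.
rewrite /uniform_mass TE cnum card_fset_set_image; last exact: face_inj.
rewrite cden natrM invfM mulrCA natr_sum mulr_suml; congr (_ * _).
apply: eq_bigr => J /eqP cJ; rewrite /cell_freq flatE// card_active_flat//.
Qed.

End WithPosition.
End Faces.

(** * Great subspheres: normals, measurability, intersections *)

Section GreatSubspheres.
Context {R : realType} {d : nat}.
Local Notation E := 'rV[R]_d.+1.
Implicit Types (x y z u : E) (V W : {vspace E}) (K : sconvex R d).

(** Without any position assumption a hyperplane costs at most one dimension. *)
Lemma dim_orth_ge (I : finType) (w : I -> E) (J : {set I}) V :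
  (\dim V <= \dim (V :&: orth w J)%VS + #|J|)%N.
Proof.
elim: {J}#|J| {1 3}J (erefl #|J|) => [|c IH] J cJ.
  move/eqP: cJ; rewrite cards_eq0 => /eqP ->.
  by rewrite /orth big_set0 capvf addn0.
have [j jJ] : exists j, j \in J by apply/set0Pn; rewrite -card_gt0 cJ.
have cJ' : #|J :\ j| = c by have := cardsD1 j J; rewrite jJ cJ => -[].
apply: leq_trans (IH _ cJ') _; rewrite addnS -addSn leq_add2r.
have -> : (V :&: orth w J = (V :&: orth w (J :\ j)) :&: hyper (w j))%VS.
  by rewrite /orth [in LHS](big_setD1 j jJ)/= -capvA [(hyper _ :&: _)%VS]capvC.
set W := (V :&: orth w (J :\ j))%VS.
have [/subvP WH|/subvPn[x Wx]] := boolP (W <= hyper (w j))%VS.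
  by rewrite (_ : (W :&: hyper (w j))%VS = W)//; apply/capv_idPl/subvP.
by rewrite mem_hyper => wx; rewrite (dim_hyper_cap Wx wx).
Qed.

Lemma dim_hyper u : u != 0 -> \dim (hyper u) = d.
Proof.
move=> u0; have uu : dot u u != 0 by rewrite dot_eq0.
have := dim_hyper_cap (memvf u) uu; rewrite capfv dimvf /dim/= mul1n.
by case.
Qed.

Lemma great_subsphere_polar K : (1 <= d)%N -> great_subsphere d.-1 K ->
  exists2 u, sphere R d u & (K : set E) = polar_hypersphere u.
Proof.
move=> d1 [V dV KE]; rewrite prednK// in dV.
pose b := fun i : 'I_(\dim V) => (vbasis V)`_i.
have [u u0 /mem_orth uo] : exists2 u, u != 0 & u \in orth b [set: 'I_(\dim V)]%SET.
  have : orth b [set: 'I_(\dim V)]%SET != 0%VS.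
    rewrite -dimv_eq0 -lt0n; have := dim_orth_ge b [set: 'I_(\dim V)]%SET fullv.
    by rewrite capfv dimvf /dim/= mul1n cardsT card_ord; move: dV; lia.
  by exists (vpick (orth b [set: 'I_(\dim V)]%SET)); rewrite ?memv_pick ?vpick0.
have VE : V = hyper u.
  apply/eqP; rewrite eqEdim dim_hyper// dV leqnn andbT.
  apply/subvP => x Vx; rewrite mem_hyper (coord_vbasis Vx) dot_sumr big1// => i _.
  by rewrite dotZr dotC uo ?inE// mulr0.
have [t t0 St] := sphere_scale u0; exists (t *: u) => //.
rewrite KE VE; apply/seteqP; split => x [/=]; rewrite mem_hyper.
  by move=> /eqP ux Sx; split => //=; rewrite dotZl ux mulr0.
by rewrite dotZl => /eqP; rewrite mulf_eq0 gt_eqF//= => ux Sx; split => //=; rewrite mem_hyper.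
Qed.

Lemma polar_great_subsphere u : (1 <= d)%N -> u != 0 -> great_subsphere d.-1 (polar_hypersphere u).
Proof.
move=> d1 u0; exists (hyper u); first by rewrite dim_hyper// prednK.
by apply/seteqP; split => x [/= ux Sx]; split => //=; move: ux; rewrite mem_hyper => /eqP.
Qed.

Lemma normal_vecP K : (1 <= d)%N -> great_subsphere d.-1 K ->
  normal_vec K != 0 /\ (K : set E) = [set y | dot (normal_vec K) y = 0] `&` sphere R d.
Proof.
move=> d1 /(great_subsphere_polar d1)[u Su KE].
have [c c0 ->] := normal_vecE Su KE.
split; first by rewrite scaler_eq0 negb_or c0 sphere_neq0.
rewrite KE; apply/seteqP; split => x [/= ux Sx]; split => //=; first by rewrite dotZl ux mulr0.
by move/eqP: ux; rewrite dotZl mulf_eq0 (negbTE c0) => /eqP.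
Qed.

Let e_ (j : 'I_d.+1) : E := delta_mx 0 j.

(** The projection of [V] to the coordinates in [J] is an isomorphism. Since there are finitely many
    sets [J], this leads to a finite description of dimension. *)
Lemma exists_coords V : exists2 J : {set 'I_d.+1}, #|J| = \dim V & (V :&: orth e_ J = 0)%VS.
Proof.
move: {2}(\dim V) (erefl (\dim V)) => v; elim: v V => [|v IH] V dV.
  exists finset.set0; first by rewrite cards0 dV.
  by move/eqP: dV; rewrite dimv_eq0 => /eqP ->; rewrite cap0v.
have [x Vx x0] : exists2 x, x \in V & x != 0.
  by exists (vpick V); rewrite ?memv_pick// vpick0 -dimv_eq0 dV.
have [i xi] : exists i, dot (e_ i) x != 0.
  have /existsP[i xi] : [exists i : 'I_d.+1, x ord0 i != 0].
    apply: contraT; rewrite negb_exists => /forallP xi.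
    apply: (contraNT _ x0) => _; apply/eqP/matrixP => k i; rewrite ord1 mxE.
    by apply/eqP; have := xi i; rewrite negbK.
  by exists i; rewrite dotC dot_delta.
have := dim_hyper_cap Vx xi; rewrite dV => -[dV'].
have [J cJ VJ] := IH _ dV'.
have iJ : i \notin J.
  apply/negP => iJ; have := dim_orth_ge e_ (J :\ i) (V :&: hyper (e_ i))%VS.
  have := cardsD1 i J; rewrite iJ add1n => cJi.
  have -> : (V :&: hyper (e_ i) :&: orth e_ (J :\ i) = V :&: hyper (e_ i) :&: orth e_ J)%VS.
    rewrite [orth e_ J](_ : _ = (hyper (e_ i) :&: orth e_ (J :\ i))%VS).
      by rewrite [in RHS]capvA -[in RHS](capvA V) capvv.
    by rewrite /orth (big_setD1 i iJ).
  by rewrite VJ dimv0 add0n -cJ cJi ltnn.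
exists (i |: J); first by rewrite cardsU1 iJ cJ dV'.
by rewrite /orth big_setU1//= capvA.
Qed.

Let coords0 (J : {set 'I_d.+1}) : set E := [set x | forall j, j \in J -> dot (e_ j) x = 0].

Let coord_ge (J : {set 'I_d.+1}) i (p : nat) : set E :=
  [set x | p.+1%:R^-1 <= dot (e_ i) x] `&` coords0 (J :\ i).

Let symmetric K := forall x, (K : set E) x -> (K : set E) (- x).

(** Symmetry makes the convex cone a linear space. Missing [coords0 J] bounds its dimension above by
    [#|J|]; a vector for each [i] in [J] whose only nonzero coordinate within [J] is the [i]-th
    bounds it below. Apart from symmetry, only hit events of closed sets occur. *)
Lemma great_subsphereP k K : great_subsphere k K <-> symmetric K /\
  exists2 J : {set 'I_d.+1}, #|J| = k.+1 &
    ~ hit (coords0 J) K /\ forall i, i \in J -> exists p, hit (coord_ge J i p) K.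
Proof.
split => [[V dV KE]|[symK [J cJ [K0 KJ]]]].
  have Ksym : symmetric K.
    move=> x; rewrite KE => -[/= Vx Sx]; split; last exact: sphereN.
    by rewrite /= memvN.
  split => //; have [J cJ VJ] := exists_coords V; exists J; first by rewrite cJ.
  have V0 x : x \in V -> coords0 J x -> x = 0.
    move=> Vx xJ; apply/eqP; rewrite -memv0 -VJ memv_cap Vx; exact/mem_orth.
  split.
    move=> [x []]; rewrite KE => -[/= Vx Sx] /(V0 x Vx) x0.
    by have := sphere_neq0 Sx; rewrite x0 eqxx.
  move=> i iJ; pose W := (V :&: orth e_ (J :\ i))%VS.
  have W0 : W != 0%VS.
    rewrite -dimv_eq0 -lt0n; have := dim_orth_ge e_ (J :\ i) V.
    have := cardsD1 i J; rewrite iJ add1n => cJi.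
    by rewrite -/W -cJ cJi addnC -addn1 leq_add2l.
  have [x [Wx Sx xi]] : exists x, [/\ x \in W, sphere R d x & 0 < dot (e_ i) x].
    have := memv_pick W; set x := vpick W => Wx.
    have x0 : x != 0 by rewrite vpick0.
    have [t t0 St] := sphere_scale x0.
    have xi : dot (e_ i) (t *: x) != 0.
      rewrite dotZr mulf_neq0 ?(gt_eqF t0)//; apply/eqP => xi; move/eqP: x0; apply.
      move: Wx; rewrite memv_cap => /andP[Vx /mem_orth xo]; apply: V0 => // j jJ.
      by have [->//|ji] := eqVneq j i; apply: xo; rewrite !inE ji.
    have [x_pos|x_neg|x00] := ltrgt0P (dot (e_ i) (t *: x)).
    - by exists (t *: x); rewrite memvZ.
    - exists (- (t *: x)); rewrite memvN memvZ//; split => //; first exact: sphereN.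
      by rewrite dotNr oppr_gt0.
    - by rewrite x00 eqxx in xi.
  have [p _ /(_ p (leqnn p))/= px] := near_infty_natSinv_lt (PosNum xi).
  move: Wx; rewrite memv_cap => /andP[Vx /mem_orth xo].
  by exists p, x; split; [rewrite KE|split => //=; exact: ltW].
have [C [[C0 Cc CZ] cC _ KE]] := sconvexP K.
have CD x y : C x -> C y -> C (x + y).
  (* A sum is twice a midpoint. *)
  move=> Cx Cy; have h01 : 0 <= (2^-1 : R) <= 1.
    by rewrite invr_ge0 ler0n invf_le1// ler1n.
  have := Cc x y (Itv01 (elimTF andP h01).1 (elimTF andP h01).2).
  rewrite !inE /conv/= => /(_ Cx Cy) /(CZ 2 _ (ler0n _ 2)).
  rewrite scalerDr !scalerA (_ : 2 * 2^-1 = 1 :> R); last by field.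
  by rewrite /unstable.onem (_ : 2 * (1 - 2^-1) = 1 :> R) ?scale1r//; field.
have CN x : C x -> C (- x).
  move=> Cx; have [->|x0] := eqVneq x 0; first by rewrite oppr0.
  have [t t0 St] := sphere_scale x0.
  have : (K : set E) (- (t *: x)) by apply: symK; rewrite KE; split => //; exact: CZ (ltW t0) Cx.
  rewrite KE => -[Ctx _]; have := CZ t^-1 _ _ Ctx.
  by rewrite scalerN scalerA mulVf ?gt_eqF// scale1r; apply; rewrite invr_ge0 ltW.
have CZr (a : R) x : C x -> C (a *: x).
  have [a0|a0] := lerP 0 a; first exact: CZ.
  by move=> /CN Cx; rewrite -[a *: x]opprK -scaleNr -scalerN; apply: CZ => //; rewrite oppr_ge0 ltW.
have Csum (I : Type) (r : seq I) (Q : pred I) (F : I -> E) :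
    (forall i, Q i -> C (F i)) -> C (\sum_(i <- r | Q i) F i).
  by move=> CF; apply: (big_ind C).
have C00 x : C x -> coords0 J x -> x = 0.
  move=> Cx xJ; apply/eqP/negPn/negP => x0; have [t t0 St] := sphere_scale x0.
  apply: K0; exists (t *: x); split; first by rewrite KE; split => //; exact: CZr.
  by move=> j jJ; rewrite dotZr xJ// mulr0.
have /choice[f fP] i : exists x, i \in J -> [/\ C x, 0 < dot (e_ i) x & coords0 (J :\ i) x].
  have [iJ|_] := boolP (i \in J); last by exists 0.
  have [p [x [+ [/= px xJ]]]] := KJ i iJ; rewrite KE => -[Cx Sx].
  by exists x => _; split => //; apply: lt_le_trans px; rewrite invr_gt0.
(* On the coordinates in [J] these vectors form a diagonal matrix with positive entries, hence are
   free. They span, since a vector of [C] that vanishes on [J] is 0. *)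
pose X := [tuple f (enum_val (A := J) i) | i < #|J|].
have XE (i : 'I_#|J|) : X`_i = f (enum_val i) by rewrite -tnth_nth tnth_mktuple.
have fE i j : i \in J -> j \in J -> i != j -> dot (e_ i) (f j) = 0.
  by move=> iJ jJ ij; have [_ _] := fP j jJ; apply; rewrite !inE ij.
have freeX : free X.
  apply/freeP => c; set s := \sum_i _ => s0 i.
  have : dot (e_ (enum_val i)) s = 0 by rewrite s0 dot0r.
  rewrite dot_sumr (bigD1 i)//= big1 ?addr0 => [|j ji].
    rewrite XE dotZr => /eqP; rewrite mulf_eq0 => /orP[/eqP//|].
    by have [_ + _] := fP _ (enum_valP i) => /gt_eqF ->.
  rewrite XE dotZr fE ?mulr0 ?enum_valP//.
  by apply: contraNneq ji => /enum_val_inj ->.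
exists <<X>>%VS; first by move/eqP: freeX => ->; rewrite size_tuple.
rewrite KE; congr (_ `&` _); apply/seteqP; split => x /=.
  move=> Cx; pose y := \sum_(i in J) (dot (e_ i) x / dot (e_ i) (f i)) *: f i.
  have yX : y \in <<X>>%VS.
    apply: memv_suml => i iJ; apply/memvZ/memv_span; apply/tnthP.
    by exists (enum_rank_in iJ i); rewrite tnth_mktuple enum_rankK_in.
  have -> // : x = y.
  apply/eqP; rewrite -subr_eq0; apply/eqP/C00.
    by apply/CD/CN/Csum => // i iJ; apply: CZr; have [] := fP i iJ.
  move=> j jJ; rewrite dotBr dot_sumr (bigD1 j)//= big1 ?addr0.
    rewrite dotZr divfK ?subrr// gt_eqF//; by have [] := fP j jJ.
  move=> i /andP[iJ ij]; have ji : j != i by rewrite eq_sym.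
  by rewrite dotZr (fE _ _ jJ iJ ji) mulr0.
move=> xX; have {xX} /coord_span -> : x \in <<X>>%VS by [].
apply: Csum => i _; apply: CZr; rewrite XE.
by have [] := fP _ (enum_valP i).
Qed.

(** Asymmetry means that some [x] in [K] has [- x] at distance at least [1/(p+1)] from [K], for some
    [p]. *)
Let measurable_symmetric : measurable symmetric.
Proof.
pose g (p : nat) (b : bool) K x : R :=
  if b then dist_to K x else p.+1%:R^-1 - dist_to K (- x).
rewrite (_ : symmetric = ~` \bigcup_(p in setT)
    [set K | exists2 x, sphere R d x & forall b, g p b K x <= 0]).
  apply: measurableC; apply: bigcupT_measurable => p; apply: measurable_proj_fin.
  - exact: sphere_compact.
  - move=> [] K /=; first exact: dist_to_continuous.
    move=> x; apply: (@cvgB _ _ _ (nbhs x)); first exact: cvg_cst.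
    apply: (@cvg_comp _ _ _ (fun x : E => - x) (dist_to K) _ (nbhs (- x))).
      by apply: (@cvgN _ _ _ (nbhs x)); exact: cvg_id.
    exact: dist_to_continuous.
  - move=> [] x /=; first exact: measurable_dist_to.
    by apply: measurable_funB; [exact: measurable_cst|exact: measurable_dist_to].
apply/seteqP; split => K.
  move=> symK [p _ [x Sx gx]]; have := gx true; rewrite /= dist_to_le0 => /asboolP Kx.
  have := gx false; rewrite /= subr_le0 leNgt => /negP; apply.
  by apply: (@le_lt_trans _ _ 0); [rewrite dist_to_le0; exact/asboolP/symK|rewrite invr_gt0].
move=> H x Kx; apply: contrapT => KNx; apply: H.
have dpos : 0 < dist_to K (- x).
  by rewrite ltNge dist_to_le0; apply/negP => /asboolP.
have [p _ /(_ p (leqnn p))/= px] := near_infty_natSinv_lt (PosNum dpos).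
exists p => //; exists x; first exact: sconvex_sphere Kx.
move=> [] /=; first by rewrite dist_to_le0; exact/asboolP.
by rewrite subr_le0 ltW.
Qed.

Lemma measurable_great_subspheres k : measurable (@great_subspheres R d k).
Proof.
rewrite (_ : @great_subspheres R d k = symmetric `&`
  \bigcup_(J in [set J : {set 'I_d.+1} | #|J| = k.+1])
    (~` hit (coords0 J) `&` \bigcap_(i in [set` J]) \bigcup_p hit (coord_ge J i p))); last first.
  apply/seteqP; split => K.
    move=> /great_subsphereP[sK [J cJ [K0 KJ]]]; split => //.
    exists J => //; split => // i /KJ[p pK].
    by exists p.
  move=> [sK [J cJ [K0 KJ]]]; apply/great_subsphereP; split => //; exists J => //.
  by split => // i /KJ[p _ pK]; exists p.
have cc0 J : closed (coords0 J).
  rewrite (_ : coords0 J = \bigcap_(j in [set` J]) [set x | dot (e_ j) x = 0]).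
    by apply: closed_bigI => j _; exact: closed_dot_eq0.
  by apply/seteqP; split.
apply: measurableI => //; apply: fin_bigcup_measurable => [|J _].
  exact: sub_finite_set (@finite_finset _ setT).
apply: measurableI; first by apply: measurableC; exact: measurable_hit.
apply: fin_bigcap_measurable => [|i _]; first exact: finite_finset.
apply: bigcupT_measurable => p; apply: measurable_hit; apply: closedI => //.
exact: closed_dot_ge.
Qed.

Lemma measurable_inter (dY : measure_display) (Y : measurableType dY) (T : finType)
    (S : T -> Y -> sconvex R d) : (forall i, measurable_fun setT (S i)) ->
  measurable_fun setT (fun t : Y => to_sconvex (sphere R d `&` \bigcap_i (S i t : set E))).
Proof.
move=> mS; apply: measurable_to_sconvex => [C cC|t [x [Sx Kx]]].
  rewrite (_ : [set t | _] = [set t | exists2 x, (sphere R d `&` C) x &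
      forall i, dist_to (S i t) x <= 0]).
    apply: measurable_proj_fin => [|i t|i x].
    - exact: compact_closedI sphere_compact cC.
    - exact: dist_to_continuous.
    - exact: (measurableT_comp (measurable_dist_to x)).
  apply/seteqP; split => [t [x [[Sx Kx] Cx]]|t [x [Sx Cx] Kx]].
    by exists x => // i; rewrite dist_to_le0; apply/asboolP/Kx.
  by exists x; split => //; split => // i _; have := Kx i; rewrite dist_to_le0 => /asboolP.
have /choice[C CP] i := sconvexP (S i t).
have CE i : (S i t : set E) = C i `&` sphere R d by have [] := CP i.
exists (\bigcap_i C i); split.
- split.
  + by move=> i _; have [[]] := CP i.
  + move=> a b s; rewrite !inE => Ca Cb i _.
    have [[_ Cc _] _ _ _] := CP i; have := Cc a b s; rewrite !inE; apply; [exact: Ca|exact: Cb].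
  + by move=> s a s0 Ca i _; have [[_ _ CZ] _ _ _] := CP i; apply: CZ => //; exact: Ca.
- by apply: closed_bigI => i _; have [] := CP i.
- move=> C0; have : (\bigcap_i C i) x by move=> i _; have := Kx i I; rewrite CE => -[].
  by rewrite C0 => /= x0; have := sphere_neq0 Sx; rewrite x0 eqxx.
- apply/seteqP; split => a.
    by move=> [Sa Ka]; split => // i _; have := Ka i I; rewrite CE => -[].
  by move=> [Ca Sa]; split => // i _; rewrite CE; split => //; exact: Ca.
Qed.

End GreatSubspheres.

Import HBNNSimple.

(** * Lower integrals and mixtures of measures *)

Section IntegralLemmas.
Context {R : realType}.
Local Open Scope ereal_scope.

(** The integral of a nonnegative function is a supremum over simple functions below it, so
    monotonicity holds without measurability. *)
Lemma le_integral_lower (d1 : measure_display) (T : measurableType d1) (mu : measure T R)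
    (f g : T -> \bar R) : (forall x, 0 <= f x) -> (forall x, f x <= g x) ->
  \int[mu]_x f x <= \int[mu]_x g x.
Proof.
move=> f0 fg; have g0 x : 0 <= g x by exact: le_trans (f0 x) (fg x).
rewrite !ge0_integralTE//; apply: ereal_sup_le => _ [h /= hf <-].
by exists h => //= x; exact: le_trans (hf x) (fg x).
Qed.

(* [f] need not be measurable: its integral is then the lower integral. *)
Lemma eq_integral_off_null (d1 : measure_display) (T : measurableType d1) (mu : measure T R)
    (N : set T) (f g : T -> \bar R) : measurable N -> mu N = 0 ->
  (forall x, 0 <= f x) -> (forall x, 0 <= g x) -> measurable_fun setT g ->
  (forall x, ~ N x -> f x = g x) -> \int[mu]_x f x = \int[mu]_x g x.
Proof.
move=> mN N0 f0 g0 mg fg; apply/eqP; rewrite eq_le; apply/andP; split.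
  (* Two measurable functions enclose [f]: [+oo] on [N] here, 0 on [N] for [l] below, both equal to
     [g] elsewhere. *)
  pose u x := if x \in N then +oo else g x.
  have mu_ : measurable_fun setT u.
    apply: measurable_fun_ifT => //.
    apply: (measurable_fun_bool true); rewrite setTI (_ : _ @^-1` _ = N)//.
    by apply/seteqP; split => x /=; [move=> /set_mem|move=> /mem_set].
  apply: (@le_trans _ _ (\int[mu]_x u x)).
    apply: le_integral_lower => // x; rewrite /u; case: ifPn => [_|]; first exact: leey.
    by move=> /negP; rewrite in_setE => /fg ->.
  rewrite (_ : \int[mu]_x u x = \int[mu]_x g x)//.
  apply: ae_eq_integral => //; exists N; split => // x /=.
  move=> H; apply: contrapT => Nx; apply: H => _; rewrite /u ifN//.
  by apply/negP; rewrite in_setE.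
pose l x := if x \in N then 0 else g x.
have ml : measurable_fun setT l.
  apply: measurable_fun_ifT => //.
  apply: (measurable_fun_bool true); rewrite setTI (_ : _ @^-1` _ = N)//.
    by apply/seteqP; split => x /=; [move=> /set_mem|move=> /mem_set].
apply: (@le_trans _ _ (\int[mu]_x l x)); last first.
  apply: le_integral_lower => x; rewrite /l; case: ifPn => // /negP.
  by rewrite in_setE => /fg ->.
rewrite (_ : \int[mu]_x l x = \int[mu]_x g x)//.
apply: ae_eq_integral => //; exists N; split => // x /=.
move=> H; apply: contrapT => Nx; apply: H => _; rewrite /l ifN//.
by apply/negP; rewrite in_setE.
Qed.

(** An identity between measures of events passes to simple functions by linearity and to [f] by
    monotone convergence, in the inner and the outer integral. *)
Lemma integral_mixture (d1 d2 : measure_display) (T : measurableType d1) (U : measurableType d2)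
    (kappa : measure U R) (D : set U) (mu : measure T R) (nu : U -> measure T R)
    (f : T -> \bar R) :
  measurable D -> (forall A, measurable A -> measurable_fun D (fun L => nu L A)) ->
  (forall A, measurable A -> mu A = \int[kappa]_(L in D) nu L A) ->
  measurable_fun setT f -> (forall x, 0 <= f x) ->
  \int[mu]_x f x = \int[kappa]_(L in D) \int[nu L]_x f x.
Proof.
move=> mD mnu munu mf f0.
pose h := nnsfun_approx measurableT mf.
have hf x : limn (fun n => (h n x)%:E) = f x.
  by apply: cvg_lim => //; exact: (cvg_nnsfun_approx measurableT mf (fun x _ => f0 x)).
have h_nd x : {homo (fun n => (h n x)%:E) : n m / (n <= m)%N >-> n <= m}.
  by move=> n m nm; rewrite lee_fin; exact/lefP/nd_nnsfun_approx.
have limI (m : measure T R) : \int[m]_x f x = limn (fun n => \int[m]_x (h n x)%:E).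
  rewrite -monotone_convergence//.
  - by apply: eq_integral => x _; rewrite hf.
  - by move=> n; apply/measurable_EFinP.
  - by move=> n x _; rewrite lee_fin.
have sE n (m : measure T R) : \int[m]_x (h n x)%:E =
    \sum_(r \in range (h n)) (r%:E * m (h n @^-1` [set r])).
  by rewrite integralT_nnsfun sintegralE.
have term0 n r L : 0 <= r%:E * nu L (h n @^-1` [set r]).
  exact: nnsfun_mulemu_ge0.
have mterm n r : measurable_fun D (fun L => r%:E * nu L (h n @^-1` [set r])).
  by apply: measurable_funeM; exact: mnu.
have swap n : \int[mu]_x (h n x)%:E = \int[kappa]_(L in D) \int[nu L]_x (h n x)%:E.
  rewrite sE; under [RHS]eq_integral do rewrite sE.
  rewrite ge0_integral_fsum//; apply: eq_fsbigr => r _; rewrite munu//.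
  have [r0|r0] := leP 0%R r; first by apply/esym/ge0_integralZl => //; exact: mnu.
  have -> : h n @^-1` [set r] = set0.
    by apply: preimage_nnfun0.
  rewrite (eq_integral (cst 0)) => [|L _]; last by rewrite measure0.
  rewrite integral0 mule0; under eq_integral do rewrite measure0 mule0.
  by rewrite integral0.
rewrite limI; under [in LHS]eq_fun do rewrite swap.
rewrite -monotone_convergence//.
- by apply: eq_integral => L _; rewrite limI.
- move=> n; under eq_fun do rewrite sE.
  by apply: emeasurable_fsum.
- by move=> n L _; apply: integral_ge0 => x _; rewrite lee_fin.
- move=> L _ n m nm; apply: ge0_le_integral => //.
  + by move=> x _; rewrite lee_fin.
  + exact/measurable_EFinP.
  + exact/measurable_EFinP.
  + by move=> x _; exact: h_nd.
Qed.

End IntegralLemmas.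

(** * Laws of finite families and change of probability space *)

Section Transfer.
Context {R : realType} {d1 : measure_display} {X : measurableType d1} {I : finType}.
Local Open Scope ereal_scope.

Definition boxes : set (set (I -> X)) :=
  [set [set s | forall i, B i (s i)] | B in [set B | forall i, measurable (B i)]].

(** Functions on a finite type with the product sigma-field. A functional of hyperspheres defined
    here can be integrated over any probability space that carries them. *)
Definition family : Type := g_sigma_algebraType boxes.
HB.instance Definition _ := Measurable.on family.

Lemma measurable_coord i : measurable_fun setT (fun s : family => s i).
Proof.
move=> _ A mA; rewrite setTI; apply: sub_sigma_algebra.
exists (fun j => if j == i then A else setT).
  by move=> j /=; case: ifP.
apply/seteqP; split => s /= H; first by have := H i; rewrite eqxx.
by move=> j; case: eqP => // ->.
Qed.

Lemma measurable_family (d2 : measure_display) (T : measurableType d2) (F : I -> T -> X) :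
  (forall i, measurable_fun setT (F i)) ->
  measurable_fun setT ((fun w => F ^~ w) : T -> family).
Proof.
move=> mF; apply: (@measurability _ _ T family setT _ boxes) => // _ [_ [B mB <-] <-].
rewrite setTI (_ : _ @^-1` _ = \bigcap_(i in setT) (F i @^-1` B i)).
  apply: fin_bigcap_measurable => [|i _]; first exact: finite_finset.
  by rewrite -[X in measurable X]setTI; exact: mF.
by apply/seteqP; split => w /= H i; [move=> _|]; exact: H.
Qed.

(** Full boxes suffice for independence, as some [B i] may be the whole space. An arbitrary finite
    index type allows sums of index types below. *)
Definition iid_law (kappa : set X -> \bar R) (d2 : measure_display) (Omega : measurableType d2)
    (P : probability Omega R) (S : I -> Omega -> X) : Prop :=
  (forall i, measurable_fun setT (S i)) /\
  forall B, (forall i, measurable (B i)) ->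
    P [set w | forall i, B i (S i w)] = \prod_i kappa (B i).

(** Boxes form a generating class stable under intersection, so both families have the same law. *)
Lemma iid_law_integral (kappa : set X -> \bar R) (d2 d3 : measure_display)
    (Omega : measurableType d2) (Omega' : measurableType d3)
    (P : probability Omega R) (P' : probability Omega' R)
    (S : I -> Omega -> X) (S' : I -> Omega' -> X) (G : family -> \bar R) :
  iid_law kappa P S -> iid_law kappa P' S' ->
  measurable_fun setT G -> (forall s, 0 <= G s) ->
  \int[P]_w G (S ^~ w) = \int[P']_w G (S' ^~ w).
Proof.
move=> [mS SP] [mS' SP'] mG G0.
pose phi : {mfun Omega >-> family} := mfun_Sub (mem_set (measurable_family mS)).
pose phi' : {mfun Omega' >-> family} := mfun_Sub (mem_set (measurable_family mS')).
rewrite -[LHS](ge0_integral_distribution phi mG G0).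
rewrite -[RHS](ge0_integral_distribution phi' mG G0).
apply: eq_measure_integral => A mA _.
apply: (@measure_unique _ _ family boxes (fun=> setT)) => //.
- move=> _ _ [B mB <-] [C mC <-]; exists (fun i => B i `&` C i).
    by move=> i /=; exact: measurableI.
  apply/seteqP; split => s /=; first by move=> H; split => i; have [] := H i.
  by move=> [H1 H2] i; split.
- by move=> _; exists (fun=> setT) => //; apply/seteqP; split.
- by rewrite bigcup_const.
- move=> _ [B mB <-]; rewrite /= /distribution /pushforward.
  by have := SP B mB; have := SP' B mB => <-.
- by move=> _; rewrite /= probability_setT ltry.
Qed.

End Transfer.

(** * Independent hyperspheres are almost surely in general position *)

Section IidFamilies.
Context {R : realType} {d : nat}.
Local Notation E := 'rV[R]_d.+1.
Local Open Scope ereal_scope.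

Lemma iid_law_inj (kappa : probability (sconvex R d) R) (dO : measure_display)
    (Omega : measurableType dO) (P : probability Omega R) n
    (S : 'I_n -> {RV P >-> sconvex R d}) (J : finType) (g : J -> 'I_n) :
  iid_hyperspheres kappa S -> injective g -> iid_law kappa P (fun j w => S (g j) w).
Proof.
move=> [_ Slaw Sind] gI; split => [j|B mB]; first exact: measurable_funPT.
pose B' (i : 'I_n) := if [pick j | g j == i] is Some j then B j else setT.
have B'g j : B' (g j) = B j.
  by rewrite /B'; case: pickP => [j' /eqP /gI -> //|/(_ j)]; rewrite eqxx.
have mB' i : measurable (B' i) by rewrite /B'; case: pickP.
rewrite (_ : [set w | _] = \bigcap_(i in [set` (g @: [set: J])%SET]) (S i @^-1` B' i)).
  rewrite Sind// big_imset/=; last by move=> i j _ _; exact: gI.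
  rewrite (eq_bigl xpredT) => [|j]; last by rewrite inE.
  by apply: eq_bigr => j _; rewrite B'g; exact: Slaw.
apply/seteqP; split => [w /= H i /= /imsetP[j _ ->]|w H j /=].
  by rewrite /= B'g.
by have := H (g j); rewrite /= B'g; apply; rewrite imset_f ?inE.
Qed.

(** A family may thus be replaced by two blocks on a product space, where one block can be
    integrated with the other fixed. *)
Lemma iid_law_prod (kappa : set (sconvex R d) -> \bar R) (d1 d2 : measure_display)
    (O1 : measurableType d1) (O2 : measurableType d2)
    (P1 : probability O1 R) (P2 : probability O2 R) (J1 J2 : finType)
    (S1 : J1 -> O1 -> sconvex R d) (S2 : J2 -> O2 -> sconvex R d) :
  iid_law kappa P1 S1 -> iid_law kappa P2 S2 ->
  iid_law kappa (P1 \x P2) (fun (j : J1 + J2) w =>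
    match j with inl i => S1 i w.1 | inr i => S2 i w.2 end).
Proof.
move=> [mS1 L1] [mS2 L2]; split => [[i|i]|B mB].
- exact: measurableT_comp (mS1 i) measurable_fst.
- exact: measurableT_comp (mS2 i) measurable_snd.
rewrite big_sumType/= -L1// -L2//.
have mbox (d3 : measure_display) (O : measurableType d3) (J : finType)
    (F : J -> O -> sconvex R d) (C : J -> set (sconvex R d)) :
    (forall i, measurable_fun setT (F i)) -> (forall i, measurable (C i)) ->
    measurable [set w | forall i, C i (F i w)].
  move=> mF mC; rewrite (_ : [set w | _] = \bigcap_(i in setT) (F i @^-1` C i)).
    apply: fin_bigcap_measurable => [|i _]; first exact: finite_finset.
    by rewrite -[X in measurable X]setTI; exact: mF.
  by apply/seteqP; split => w /= H i; [move=> _|]; exact: H.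
rewrite -(product_measure1E _ _ (mbox _ _ _ _ _ mS1 (fun i => mB (inl i)))
  (mbox _ _ _ _ _ mS2 (fun i => mB (inr i)))).
congr (_ _); apply/seteqP; split => -[w1 w2] /=.
  by move=> H; split => i; [exact: (H (inl i))|exact: (H (inr i))].
by move=> [H1 H2] [i|i].
Qed.

Lemma polar_spherically_convex (u : E) : (1 <= d)%N -> u != 0%R ->
  spherically_convex (polar_hypersphere u).
Proof.
move=> d1 u0; exists [set x | dot u x = 0%R]; split => //.
- split => /=; first by rewrite dot0r.
    move=> x y t; rewrite !inE/= => ux uy.
    by rewrite /conv/= dotDr !dotZr ux uy !mulr0 addr0.
  by move=> t x _ /= ux; rewrite dotZr ux mulr0.
- exact: closed_dot_eq0.
- move=> u1; have := dim_hyper u0; suff -> : hyper u = 0%VS.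
    by rewrite dimv0 => d0; move: d1; rewrite -d0.
  apply/eqP; rewrite -subv0; apply/subvP => x; rewrite mem_hyper => /eqP ux.
  have : [set x | dot u x = 0%R] x by [].
  by rewrite u1 => /= ->; exact: mem0v.
Qed.

(** The polar of [u] contains [x] exactly when [u] lies in the polar of [x], a great hypersphere and
    hence [kappa0]-null. *)
Lemma nondegenerate_point (kappa : probability (sconvex R d) R) (x : E) : (1 <= d)%N ->
  nondegenerate_directional kappa -> sphere R d x ->
  kappa (hit [set x]) = 0.
Proof.
move=> d1 [kappa0 [_ k0 kE]] Sx; rewrite kE; last exact: measurable_hit1.
rewrite -(k0 (polar_hypersphere x)); last exact: polar_great_subsphere (sphere_neq0 Sx).
congr (_ _); apply/seteqP; split => u /=.
  move=> [K [y [Ky /= yx]] uK]; move: Ky; rewrite yx -uK => -[/= ux _].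
  by split; [rewrite /= dotC|exact: set_valP].
move=> [/= xu Su]; exists (SConvex (polar_spherically_convex d1 (sphere_neq0 Su))) => //.
by exists x; split => //; split => //=; rewrite dotC.
Qed.

(* Failure of general position, in a form that is measurable in [s]. *)
Definition degenerate (I : finType) (s : I -> sconvex R d) (J : {set I}) (j : I) : Prop :=
  let F := sphere R d `&` \bigcap_(i in [set` J]) (s i : set E) in
  F !=set0 /\ F `<=` s j.

(** The inclusion fails when a point of the intersection has distance at least [1/(p+1)] from the
    hypersphere of [j] for some [p], a countable union of projections. *)
Lemma measurable_degenerate (dY : measure_display) (Y : measurableType dY) (I : finType)
    (S : I -> Y -> sconvex R d) (J : {set I}) j : (forall i, measurable_fun setT (S i)) ->
  measurable [set t : Y | degenerate (S ^~ t) J j].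
Proof.
move=> mS.
pose g (i : I) (t : Y) (x : E) : R := if i \in J then dist_to (S i t) x else 0%R.
pose h (p : nat) (i : option I) (t : Y) (x : E) : R :=
  if i is Some i then g i t x else (p.+1%:R^-1 - dist_to (S j t) x)%R.
have gc i t : continuous (g i t).
  have [iJ|iJ] := boolP (i \in J).
    rewrite (_ : g i t = dist_to (S i t)); first exact: dist_to_continuous.
    by apply/funext => x; rewrite /g iJ.
  rewrite (_ : g i t = cst 0%R); first exact: cst_continuous.
  by apply/funext => x; rewrite /g (negbTE iJ).
have gm i x : measurable_fun setT (fun t => g i t x).
  have [iJ|iJ] := boolP (i \in J).
    rewrite (_ : (g i)^~ x = (fun t => dist_to (S i t) x)).
      exact: (measurableT_comp (measurable_dist_to x)).
    by apply/funext => t; rewrite /g iJ.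
  rewrite (_ : (g i)^~ x = cst 0%R); first exact: measurable_cst.
  by apply/funext => t; rewrite /g (negbTE iJ).
have gP t x : (forall i, (g i t x <= 0)%R) <-> (\bigcap_(i in [set` J]) (S i t : set E)) x.
  split => [H i iJ|H i]; first by have := H i; rewrite /g iJ dist_to_le0 => /asboolP.
  by rewrite /g; case: ifPn => // iJ; rewrite dist_to_le0; apply/asboolP/H.
rewrite (_ : [set t | _] = [set t | exists2 x, sphere R d x & forall i, (g i t x <= 0)%R] `\`
    \bigcup_p [set t | exists2 x, sphere R d x & forall i, (h p i t x <= 0)%R]).
  apply: measurableD; first by apply: measurable_proj_fin => //; exact: sphere_compact.
  apply: bigcupT_measurable => p; apply: measurable_proj_fin => [|[i|] t|[i|] x] /=.
  - exact: sphere_compact.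
  - exact: gc.
  - move=> x; apply: (@cvgB _ _ _ (nbhs x)); first exact: cvg_cst.
    exact: dist_to_continuous.
  - exact: gm.
  - apply: measurable_funB; first exact: measurable_cst.
    exact: (measurableT_comp (measurable_dist_to x)).
apply/seteqP; split => t.
  move=> [[x [Sx Fx]] FJ]; split; first by exists x => //; exact/gP.
  move=> [p _ [y Sy hy]]; have := hy None; rewrite /= subr_le0 leNgt => /negP; apply.
  apply: (@le_lt_trans _ _ 0%R); last by rewrite invr_gt0.
  rewrite dist_to_le0; apply/asboolP/FJ; split => //.
  by apply/gP => i; exact: (hy (Some i)).
move=> [[x Sx /gP Fx] H]; split; first by exists x.
move=> y [Sy Fy]; apply: contrapT => jy; apply: H.
have dpos : (0 < dist_to (S j t) y)%R.
  by rewrite ltNge dist_to_le0; apply/negP => /asboolP.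
have [p _ /(_ p (leqnn p))/= px] := near_infty_natSinv_lt (PosNum dpos).
exists p => //; exists y => // -[i|] /=; first by move: i; exact/gP.
by rewrite subr_le0 ltW.
Qed.

Lemma general_position_normal_vec (I : finType) (s : I -> sconvex R d) : (1 <= d)%N ->
  (forall i, great_subsphere d.-1 (s i)) ->
  (forall (J : {set I}) j, j \notin J -> ~ degenerate s J j) ->
  general_position fullv (fun i => normal_vec (s i)).
Proof.
move=> d1 gs nd J j jJ; rewrite capfv => o0.
have sE i x : sphere R d x -> (s i : set E) x <-> dot (normal_vec (s i)) x = 0%R.
  by move=> Sx; have [_ ->] := normal_vecP d1 (gs i); split => [[]|].
have FP x : sphere R d x -> x \in orth (fun i => normal_vec (s i)) J <->
    (\bigcap_(i in [set` J]) (s i : set E)) x.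
  move=> Sx; split => [/mem_orth H i /H|H]; first by move=> Hx; exact/sE.
  by apply/mem_orth => i iJ; apply/sE => //; exact: H.
apply: contrapT => H; apply: (nd J j jJ); split.
  have x0 : vpick (orth (fun i => normal_vec (s i)) J) != 0%R by rewrite vpick0.
  have [t t0 St] := sphere_scale x0.
  by eexists; split; [exact: St|apply/FP => //; rewrite memvZ// memv_pick].
move=> x [Sx Fx]; apply/sE => //; apply/eqP/negPn/negP => wx; apply: H.
by exists x => //; exact/FP.
Qed.

(** With the other hyperspheres fixed, the intersection over [J] is a fixed set. If it contains a
    point [x0], degeneracy forces [x0] into [S j], an event of probability 0. *)
Lemma degenerate_null (kappa : probability (sconvex R d) R) (dO : measure_display)
    (Omega : measurableType dO) (P : probability Omega R) n
    (S : 'I_n -> {RV P >-> sconvex R d}) (J : {set 'I_n}) j : (1 <= d)%N ->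
  nondegenerate_directional kappa -> iid_hyperspheres kappa S -> j \notin J ->
  P [set w | degenerate (fun i => S i w) J j] = 0.
Proof.
move=> d1 nd iS jJ.
(* Splitting off [j] as a separate summand puts [S j] on a second factor of the product space. *)
pose T := ({i : 'I_n | i != j} + unit)%type.
pose g (t : T) : 'I_n := match t with inl i => val i | inr _ => j end.
have gI : injective g.
  move=> [i|[]] [i'|[]] //=; first by move=> /val_inj ->.
    by move=> ij; have /negP[] := valP i; apply/eqP.
  by move=> ij; have /negP[] := valP i'; apply/eqP.
pose J' : {set T} := [set t | g t \in J]%SET.
have degE (s : 'I_n -> sconvex R d) : degenerate s J j <->
    degenerate (fun t => s (g t)) J' (inr tt).
  rewrite /degenerate /=.
  suff -> : \bigcap_(i in [set` J]) (s i : set E) =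
    \bigcap_(t in [set` J']) (s (g t) : set E) by [].
  apply/seteqP; split => x H.
    by move=> t /=; rewrite inE => /H.
  move=> i iJ; have ij : i != j by apply: contraTneq iJ => ->.
  by apply: (H (inl (exist _ i ij))); rewrite /= inE.
pose N : set (@family _ (sconvex R d) T) := [set s | degenerate s J' (inr tt)].
have mN : measurable N by apply: (measurable_degenerate _ _ (@measurable_coord _ _ T)).
pose G (s : @family _ (sconvex R d) T) : \bar R := (\1_N s)%:E.
have mG : measurable_fun setT G by apply/measurable_EFinP; exact: measurable_indic.
have L1 := @iid_law_inj kappa _ _ P n S _ (val : {i : 'I_n | i != j} -> 'I_n) iS val_inj.
have L2 := @iid_law_inj kappa _ _ P n S unit (fun=> j) iS ltac:(by move=> [] []).
have LT := @iid_law_inj kappa _ _ P n S _ g iS gI.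
have mD : measurable [set w | degenerate (fun i => S i w) J j].
  by apply: measurable_degenerate => i; exact: measurable_funPT.
have -> : P [set w | degenerate (fun i => S i w) J j] = \int[P]_w G (fun t => S (g t) w).
  rewrite -(setIT [set w | _]) -integral_indic//; apply: eq_integral => w _.
  rewrite /G !indicE; congr (_%:R%:E); congr nat_of_bool.
  apply/idP/idP => /set_mem H; apply/mem_set.
    exact: (degE (fun i => S i w)).1.
  exact: (degE (fun i => S i w)).2.
rewrite (iid_law_integral LT (iid_law_prod L1 L2) mG); last by move=> s; rewrite lee_fin.
rewrite fubini_tonelli1; last first.
- by move=> s; rewrite lee_fin.
- exact: measurableT_comp mG (measurable_family (iid_law_prod L1 L2).1).
rewrite integral0_eq// => w1 _; rewrite /fubini_F.
pose F : set E := sphere R d `&` \bigcap_(i in [set` J]) (S i w1 : set E).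
pose sw (w2 : Omega) (t : T) : sconvex R d :=
  match t with inl i => S (val i) w1 | inr _ => S j w2 end.
have FE w2 : sphere R d `&` \bigcap_(t in [set` J']) (sw w2 t : set E) = F.
  apply/seteqP; split => x [Sx H]; split => //.
    move=> i iJ; have ij : i != j by apply: contraTneq iJ => ->.
    by apply: (H (inl (exist _ i ij))); rewrite /= inE.
  move=> [i|[]] /=; rewrite inE /=; first by move=> iJ; exact: H.
  by rewrite (negbTE jJ).
have [[x0 Fx0]|F0] := pselect (F !=set0); last first.
  apply: integral0_eq => w2 _; rewrite /G indicE memNset// /N /= /degenerate/=.
  by move=> [H _]; apply: F0; rewrite -(FE w2); exact: H.
apply/eqP; rewrite eq_le integral_ge0 ?andbT => [|w2 _]; last by rewrite lee_fin.
have mhit : measurable (S j @^-1` hit [set x0]).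
  rewrite -[X in measurable X]setTI; apply: measurable_funPT => //.
  exact: measurable_hit1.
apply: (@le_trans _ _ (\int[P]_w (\1_(S j @^-1` hit [set x0]) w)%:E)).
  apply: le_integral_lower => w2; first by rewrite lee_fin.
  rewrite lee_fin /G !indicE; case: (boolP (_ \in N)) => //= /set_mem [_ H].
  rewrite mem_set//= ; exists x0; split => //.
  by apply: H; have := Fx0; rewrite -(FE w2); exact.
rewrite integral_indic// setIT; have [_ Slaw _] := iS.
have PE : P (S j @^-1` hit [set x0]) = 0.
  by have := Slaw j _ (measurable_hit1 x0); rewrite (nondegenerate_point d1 nd Fx0.1); exact.
exact: (eq_ind_r (fun z => z <= 0) (lexx 0) PE).
Qed.

End IidFamilies.

(** The left summand enumerates [J] and, by injectivity and cardinality, the right one its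
    complement. For other cardinalities the map is arbitrary. *)
Lemma subset_enumerations (n a b : nat) : (a + b = n)%N ->
  exists g : {set 'I_n} -> 'I_a + 'I_b -> 'I_n, forall J : {set 'I_n}, #|J| = a ->
    injective (g J) /\ forall j, (j \in J) = [exists i, g J (inl i) == j].
Proof.
move=> abn.
suff /choice[g gP] : forall J : {set 'I_n}, exists g : 'I_a + 'I_b -> 'I_n, #|J| = a ->
    injective g /\ forall j, (j \in J) = [exists i, g (inl i) == j].
  by exists g.
move=> J; have [cJ|cJ] := eqVneq #|J| a; last first.
  have an : (a <= n)%N by rewrite -abn leq_addr.
  have bn : (b <= n)%N by rewrite -abn leq_addl.
  exists (fun t => match t with inl i => widen_ord an i | inr i => widen_ord bn i end).
  by move=> H; rewrite H eqxx in cJ.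
have cJ' : #|~: J| = b by apply: (@addnI a); have := cardsC J; rewrite cJ card_ord abn.
pose fa i := enum_val (cast_ord (esym cJ) i).
pose fb i := enum_val (cast_ord (esym cJ') i).
have faJ i : fa i \in J by exact: enum_valP.
have fbJ i : fb i \notin J by have := enum_valP (cast_ord (esym cJ') i); rewrite inE.
exists (fun t => match t with inl i => fa i | inr i => fb i end) => _; split.
  move=> [i|i] [i'|i'] //=.
  - by move=> /enum_val_inj /cast_ord_inj ->.
  - by move=> H; have := fbJ i'; rewrite -H faJ.
  - by move=> H; have := fbJ i; rewrite H faJ.
  - by move=> /enum_val_inj /cast_ord_inj ->.
move=> j; apply/idP/existsP => [jJ|[i /eqP <-]//].
exists (cast_ord cJ (enum_rank_in jJ j)); apply/eqP.
by rewrite /fa cast_ordK enum_rankK_in.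
Qed.

(** * The law of the typical face as an iterated integral *)

Section FaceLaw.
Context {R : realType} {d : nat}.
Local Notation E := 'rV[R]_d.+1.
Local Open Scope ereal_scope.

(** At most [d] linear equations in dimension [d + 1] have a nonzero solution, so the default value
    of [to_sconvex] does not occur. *)
Lemma inter_polar (I : finType) (s : I -> sconvex R d) : (1 <= d)%N -> (#|I| <= d)%N ->
  (forall i, great_subsphere d.-1 (s i)) ->
  (to_sconvex (sphere R d `&` \bigcap_i (s i : set E)) : set E) =
  sphere R d `&` \bigcap_i (s i : set E).
Proof.
move=> d1 Id gs; apply: to_sconvexE.
have sE i := (normal_vecP d1 (gs i)).2.
pose o := orth (fun i => normal_vec (s i)) [set: I]%SET.
have on0 : o != 0%VS.
  rewrite -dimv_eq0 -lt0n; have := dim_orth_ge (fun i => normal_vec (s i)) [set: I]%SET fullv.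
  by rewrite capfv dimvf /dim/= mul1n cardsT -/o; move: Id; lia.
have FE : sphere R d `&` \bigcap_i (s i : set E) = [set x | x \in o] `&` sphere R d.
  apply/seteqP; split => x.
    move=> [Sx H]; split => //=; apply/mem_orth => i _.
    by have := H i Logic.I; rewrite sE => -[].
  by move=> [/= /mem_orth H Sx]; split => // i _; rewrite sE; split => //=; apply: H; rewrite inE.
rewrite FE; exists [set x | x \in o]; split => //.
- split => /=; first exact: mem0v.
    by move=> x y t; rewrite !inE/= => xo yo; rewrite memvD// memvZ.
  by move=> t x _ xo; rewrite memvZ.
- rewrite (_ : [set x | _] = \bigcap_i [set x | dot (normal_vec (s i)) x = 0%R]).
    by apply: closed_bigI => j _; exact: closed_dot_eq0.
  apply/seteqP; split => x; first by move=> /mem_orth xo j _; apply: xo; rewrite inE.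
  by move=> H; apply/mem_orth => j _; exact: H.
- move=> o0; move: on0; rewrite -subv0 => /subvP; apply => x xo.
  have : [set x | x \in o] x by [].
  by rewrite o0 => /= ->; exact: mem0v.
Qed.

Variables (k n : nat) (kappa : probability (sconvex R d) R).
Hypotheses (hd : (1 <= d)%N) (hk : (k <= d)%N) (hn : (d - k <= n)%N).
Hypothesis hkappa : nondegenerate_directional kappa.

Local Notation a := (d - k)%N.
(** Adding before subtracting avoids truncation when [n < d]. *)
Local Notation b := (n + k - d)%N.

Let flat_of (J : finType) (s : J -> sconvex R d) : sconvex R d :=
  to_sconvex (sphere R d `&` \bigcap_i (s i : set E)).

(** The left indices carry the hyperspheres that cut out the flat, the right ones those that
    subdivide it. *)
Let freq (A : set (sconvex R d)) (s : @family _ (sconvex R d) ('I_a + 'I_b)%type) : \bar R :=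
  (cell_freq (fun i => normal_vec (s (inr i))) (flat_of (fun i => s (inl i))) A)%:E.

Let measurable_freq A : measurable A -> measurable_fun setT (freq A).
Proof.
move=> mA; apply/measurable_EFinP.
apply: (@measurable_cell_freq _ _ _ (@family _ (sconvex R d) ('I_a + 'I_b)%type) _
  (fun s => flat_of (fun i => s (inl i))) (fun i s => normal_vec (s (inr i)))) => //.
- by apply: measurable_inter => i; exact: measurable_coord.
- move=> j x; exact: measurableT_comp (measurable_dot_normal_vec x) (measurable_coord _).
Qed.

Let freq_ge0 A s : 0 <= freq A s.
Proof. by rewrite lee_fin cell_freq_ge0. Qed.

Lemma face_law (dO d1 d2 : measure_display) (Omega : measurableType dO)
    (O1 : measurableType d1) (O2 : measurableType d2)
    (P : probability Omega R) (P1 : probability O1 R) (P2 : probability O2 R)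
    (S : 'I_n -> {RV P >-> sconvex R d}) (S1 : 'I_a -> {RV P1 >-> sconvex R d})
    (S2 : 'I_b -> {RV P2 >-> sconvex R d}) (A : set (sconvex R d)) :
  iid_hyperspheres kappa S -> iid_hyperspheres kappa S1 -> iid_hyperspheres kappa S2 ->
  measurable A ->
  \int[P]_w (uniform_mass (tess_faces k (random_tess S w)) A)%:E =
  \int[P1]_x \int[P2]_y (cell_freq (fun i => normal_vec (S2 i y))
    (flat_of (fun i => S1 i x)) A)%:E.
Proof.
move=> iS iS1 iS2 mA.
have abn : (a + b = n)%N by lia.
have [g gP] := subset_enumerations abn.
pose sets : seq {set 'I_n} := seq.filter (fun J : {set 'I_n} => #|J| == a) (index_enum _).
pose gS (J : {set 'I_n}) (w : Omega) : @family _ (sconvex R d) ('I_a + 'I_b)%type :=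
  fun t => S (g J t) w.
pose F w : \bar R := (('C(n, a)%:R : R)^-1)%:E * \sum_(J <- sets) freq A (gS J w).
have mS j : measurable_fun setT (S j) by exact: measurable_funPT.
have mfreqS J : measurable_fun setT (fun w => freq A (gS J w)).
  exact: measurableT_comp (measurable_freq mA) (measurable_family (fun t => mS (g J t))).
have mF : measurable_fun setT F.
  by apply: measurable_funeM; apply: emeasurable_sum => J.
have F0 w : 0 <= F w.
  by rewrite mule_ge0 ?lee_fin ?invr_ge0//; apply: sume_ge0.
(* A finite union of null events; off it the faces are given by [uniform_mass_faces]. *)
pose N := \bigcup_(p in [set p : {set 'I_n} * 'I_n | p.2 \notin p.1])
  [set w | degenerate (fun i => S i w) p.1 p.2].
have mdeg (J : {set 'I_n}) j : measurable [set w | degenerate (fun i => S i w) J j].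
  exact: measurable_degenerate.
have mN : measurable N.
  by apply: fin_bigcup_measurable => [|p _]; [exact: finite_finset|exact: mdeg].
have N0 : P N = 0.
  apply/eqP; rewrite eq_le measure_ge0 andbT.
  have fN : finite_set [set p : {set 'I_n} * 'I_n | p.2 \notin p.1] by exact: finite_finset.
  have := @content_sub_fsum _ _ _ P _ _ N _ fN (fun p _ => mdeg p.1 p.2) mN (@subset_refl _ N).
  move=> /le_trans; apply; rewrite fsbig1// => -[J j] /= jJ.
  exact: degenerate_null hd hkappa iS jJ.
have gs j w : great_subsphere d.-1 (S j w) by have [H _ _] := iS; exact: H.
have umF w : ~ N w -> (uniform_mass (tess_faces k (random_tess S w)) A)%:E = F w.
  move=> Nw.
  have gp : general_position fullv (fun i => normal_vec (S i w)).
    apply: (@general_position_normal_vec _ _ _ (fun i => S i w)) => // J j jJ deg.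
    by apply: Nw; exists (J, j).
  have SE j := (normal_vecP hd (gs j w)).2.
  have bP (J : {set 'I_n}) : #|J| = a -> injective (fun i : 'I_b => g J (inr i)) /\
      forall j, (j \in J) = ~~ [exists i : 'I_b, g J (inr i) == j].
    move=> cJ; have [gI gJ] := gP J cJ; split; first by move=> i i' /gI [].
    move=> j; rewrite gJ; apply/existsP/existsPn => [[i /eqP <-] i'|H].
      by apply/eqP => /gI.
    have gB : bijective (g J).
      by apply: inj_card_bij gI _; rewrite card_sum !card_ord abn.
    have [[i|i] ij] : exists t, g J t = j by have [g' _ g'K] := gB; exists (g' j).
      by exists i; apply/eqP.
    by have := H i; rewrite ij eqxx.
  rewrite /random_tess (uniform_mass_faces hk gp bP A SE).
  rewrite EFinM -sumEFin /F big_filter; congr (_ * _); apply: eq_bigr => J /eqP cJ.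
  rewrite /freq; congr (cell_freq _ (to_sconvex _) _)%:E.
  have [gI gJ] := gP J cJ.
  apply/seteqP; split => x.
    move=> [/= /mem_orth xJ Sx]; split => // i _; rewrite /gS SE; split => //=.
    by apply: xJ; rewrite gJ; apply/existsP; exists i.
  move=> [Sx xJ]; split => //=; apply/mem_orth => j; rewrite gJ => /existsP[i /eqP <-].
  by have := xJ i Logic.I; rewrite /gS SE => -[].
rewrite (eq_integral_off_null mN N0 (g := F))//; last by move=> w; rewrite lee_fin divr_ge0.
rewrite /F ge0_integralZl//; last 2 first.
- by apply: emeasurable_sum => J.
- by move=> w _; apply: sume_ge0.
rewrite ge0_integral_sum//.
have L1 := @iid_law_inj R d kappa _ _ P1 a S1 _ id iS1 (@inj_id _).
have L2 := @iid_law_inj R d kappa _ _ P2 b S2 _ id iS2 (@inj_id _).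
have L12 := iid_law_prod L1 L2.
(* The explicit factor 1 lets the sum factor as the number of sets [J] times the common value; this
   number cancels the binomial coefficient. *)
rewrite (eq_big_seq (fun=> 1%:E * \int[P1]_x \int[P2]_y
    (cell_freq (fun i => normal_vec (S2 i y)) (flat_of (fun i => S1 i x)) A)%:E)); last first.
  move=> J; rewrite mul1e; rewrite mem_filter => /andP[/eqP cJ _].
  have [gI _] := gP J cJ.
  rewrite (iid_law_integral (iid_law_inj iS gI) L12 (measurable_freq mA))//.
  rewrite fubini_tonelli1//.
  exact: measurableT_comp (measurable_freq mA) (measurable_family L12.1).
rewrite -ge0_sume_distrl// sumEFin big_const_seq count_predT iter_addr_0.
have -> : size sets = 'C(n, a).
  rewrite -sum1_size big_filter sum1_card -[n in RHS]card_ord -card_draws.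
  by apply: eq_card => J; rewrite inE unfold_in.
rewrite muleA -EFinM mulVf ?mul1e// pnatr_eq0 -lt0n bin_gt0//.
Qed.

End FaceLaw.

Theorem theorem3p3 (R : realType) (d k n : nat)
  (hd : (1 <= d)%N) (hk : (k <= d)%N) (hn : (d - k <= n)%N)
  (kappa : probability (sconvex R d) R)
  (hkappa : nondegenerate_directional kappa)
  (h : sconvex R d -> R) (h_ge0 : forall K, 0 <= h K)
  (h_meas : measurable_fun setT h)
  (* the tessellation T_{n,d} and its typical k-face *)
  (dO : measure_display) (Omega : measurableType dO)
  (P : probability Omega R)
  (S : 'I_n -> {RV P >-> sconvex R d}) (hS : iid_hyperspheres kappa S)
  (Z : {RV P >-> sconvex R d}) (hZ : typical_face k S Z)
  (* the tessellation T_{n-d+k,d} and the typical cells of its sections *)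
  (dO' : measure_display) (Omega' : measurableType dO')
  (P' : probability Omega' R)
  (S' : 'I_(n + k - d) -> {RV P' >-> sconvex R d})
  (hS' : iid_hyperspheres kappa S')
  (Z' : sconvex R d -> {RV P' >-> sconvex R d})
  (hZ' : forall L, great_subspheres k L -> typical_section_cell S' L (Z' L))
  (kappa_k : probability (sconvex R d) R)
  (hkappa_k : intersection_distribution kappa k kappa_k) :
  ('E_P[h \o Z] =
   \int[kappa_k]_(L in great_subspheres k) 'E_P'[h \o Z' L])%E.
Proof.
have [d2 [Om'' [P'' [S'' [iS'' kE]]]]] := hkappa_k.
have gs'' i w : great_subsphere d.-1 (S'' i w) by have [H _ _] := iS''; exact: H.
have gs' i w : great_subsphere d.-1 (S' i w) by have [H _ _] := hS'; exact: H.
pose Lam w := to_sconvex (sphere R d `&` \bigcap_i (S'' i w : set _)).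
have LamE w : (Lam w : set _) = sphere R d `&` \bigcap_i (S'' i w : set _).
  by apply: inter_polar => //; rewrite card_ord leq_subr.
have mLam : measurable_fun setT Lam.
  by apply: measurable_inter => i; exact: measurable_funPT.
pose LamRV : {RV P'' >-> sconvex R d} := mfun_Sub (mem_set mLam).
pose G := @great_subspheres R d k.
have mG : measurable G by exact: measurable_great_subspheres.
have kappaG A : measurable A -> kappa_k A = P'' (Lam @^-1` (A `&` G)).
  move=> mA; rewrite kE//; congr (P'' _); apply/seteqP; split => w /=.
    move=> [L AL]; rewrite -LamE => /sconvex_inj ->; exact: AL.
  by move=> AL; exists (Lam w).
have kG : kappa_k (~` G) = 0%E by rewrite kappaG ?setICl ?preimage_set0//; exact: measurableC.
(* The total mass 1 of [kappa_k] forces the random flat to lie in [G] almost surely, so the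
   intersection with [G] may be dropped. *)
have kappaE A : measurable A -> kappa_k A = distribution P'' LamRV A.
  move=> mA; have LG : distribution P'' LamRV (~` G) = 0%E.
    have LG : distribution P'' LamRV G = 1%E.
      by apply/esym; have := kappaG setT measurableT; rewrite setTI probability_setT.
    apply: (etrans (probability_setC _ mG)).
    by apply: (etrans (congr1 (fun z => 1 - z)%E LG)); exact: subee.
  have AG0 : distribution P'' LamRV (A `\` G) = 0%E.
    apply: (subset_measure0 _ _ _ LG); [exact: measurableD|exact: measurableC|].
    by move=> L [].
  rewrite kappaG//; apply/esym/(etrans (measureDI _ mA mG)).
  apply: (etrans (congr1 (fun z => z + _)%E AG0)); exact: add0e.
pose phi A L : \bar R := (\int[P']_y (cell_freq (fun i => normal_vec (S' i y)) L A)%:E)%E.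
have phi0 A L : (0 <= phi A L)%E.
  by apply: integral_ge0 => y _; rewrite lee_fin cell_freq_ge0.
have mphi A : measurable A -> measurable_fun setT (phi A).
  move=> mA.
  pose F (z : sconvex R d * Omega') := (cell_freq (fun i => normal_vec (S' i z.2)) z.1 A)%:E.
  have mF : measurable_fun setT F.
    apply/measurable_EFinP.
    apply: (@measurable_cell_freq _ _ _ (sconvex R d * Omega')%type _
      (fun z => z.1) (fun i z => normal_vec (S' i z.2))) => //.
      exact: measurable_fst.
    move=> j x; apply: measurableT_comp (measurable_dot_normal_vec x) _.
    by apply: measurableT_comp; [exact: measurable_funPT|exact: measurable_snd].
  apply: (@measurable_fun_fubini_tonelli_F _ _ _ _ _ P' F) => //.
  by move=> z; rewrite lee_fin cell_freq_ge0.
(* Taking [setT] as the conditioning event gives the unconditional law of the typical cell. *)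
have nuE L A : G L -> measurable A -> distribution P' (Z' L) A = phi A L.
  move=> GL mA; have := hZ' L GL A setT mA; rewrite !preimage_setT setIT.
  move=> /(_ measurableT) H; apply: (etrans H).
  apply: eq_integral => y _; congr _%:E.
  have sE i := normal_vecP hd (gs' i y).
  by rewrite /random_tess (uniform_mass_section L A (fun i => (sE i).1) (fun i => (sE i).2)).
have muE A : measurable A -> (distribution P Z A = \int[kappa_k]_(L in G) phi A L)%E.
  move=> mA; have := hZ A setT mA; rewrite !preimage_setT setIT.
  move=> /(_ measurableT) H; apply: (etrans H).
  rewrite (face_law hd hk hn hkappa hS iS'' hS' mA).
  rewrite -[LHS]/(\int[P'']_x (phi A (LamRV x)))%E.
  rewrite -(ge0_integral_distribution LamRV (mphi A mA) (phi0 A)).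
  rewrite (eq_measure_integral kappa_k) => [|B mB _]; last by apply/esym/kappaE.
  (* Restricting to [G] alters the integrand only on a [kappa_k]-null set. *)
  rewrite [RHS]integral_mkcond; apply/esym.
  apply: (eq_integral_off_null (measurableC mG) kG) => //.
  - by move=> L; rewrite /patch; case: ifP.
  - by apply: mphi.
  - by move=> L /contrapT GL; rewrite /patch mem_set.
have Eh (dT : measure_display) (T : measurableType dT) (Q : probability T R)
    (X : {RV Q >-> sconvex R d}) :
    ('E_Q[h \o X] = \int[distribution Q X]_K (h K)%:E)%E.
  rewrite unlock ge0_integral_distribution//; exact/measurable_EFinP.
rewrite Eh; transitivity (\int[kappa_k]_(L in G) \int[distribution P' (Z' L)]_K (h K)%:E)%E;
  last by apply: eq_integral => L _; exact/esym/(Eh _ _ _ (Z' L)).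
(* On events, the law of [Z] is the [kappa_k]-mixture of the laws of the [Z' L]; this carries over
   to [h]. *)
apply: (integral_mixture mG) => //.
- move=> A mA; apply: (eq_measurable_fun (phi A)).
    by move=> L /set_mem GL; exact/esym/nuE.
  exact: measurable_funS (mphi A mA).
- move=> A mA; apply: (etrans (muE A mA)); apply: eq_integral => L /set_mem GL.
  exact/esym/nuE.
exact/measurable_EFinP.
Qed.
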